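(* For each $m\ge2$, $\mathcal P_m^+$ consists of $r_m:=2^m+2^{m-2}-2$ distinct eigenvalues of multiplicity $1$, lying strictly between $0$ and $6$; denoting them by $\lambda_{m,1},\dots,\lambda_{m,r_m}$ in increasing order, $$0<\lambda_{m,1}<\lambda_{m,2}<\cdots<\lambda_{m,r_m-1}<5<\lambda_{m,r_m}<6 .$$ Moreover $r_{m+1}=2r_m+2$ and, with $\phi_\pm(x)=\frac{5\pm\sqrt{25-4x}}{2}$, \begin{align*} 0&<\lambda_{m+1,1}<\phi_-(\lambda_{m,1}),\\ \phi_-(\lambda_{m,k-1})&<\lambda_{m+1,k}<\phi_-(\lambda_{m,k}),\quad 2\le k\le r_m,\\ \phi_-(\lambda_{m,r_m})&<\lambda_{m+1,r_m+1}<\phi_+(\lambda_{m,r_m}),\\ \phi_+(\lambda_{m,2r_m+2-k})&<\lambda_{m+1,k}<\phi_+(\lambda_{m,2r_m+1-k}),\quad r_m+2\le k\le 2r_m,\\ \phi_+(\lambda_{m,1})&<\lambda_{m+1,2r_m+1}<5,\\ 5&<\lambda_{m+1,2r_m+2}<6 . \end{align*} The same statements hold for $\mathcal P_m^-$ with $r_m$ replaced throughout by $s_m:=2^m-2$.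
   Context: Let $q_0,q_1,q_2$ be the vertices of an equilateral triangle in the plane, $F_i x=\frac12(x+q_i)$, and let $\mathcal{SG}$ be the attractor of $\{F_0,F_1,F_2\}$. For a word $w=w_1\cdots w_n$ put $F_w=F_{w_1}\circ\cdots\circ F_{w_n}$. $V_0=\{q_0,q_1,q_2\}$, $V_m=\bigcup_{|w|=m}F_w(V_0)$; distinct $x,y\in V_m$ satisfy $x\sim_m y$ iff both lie in $F_w(V_0)$ for some word $w$ of length $m$. $L$ is the closed segment joining $q_1$ and $q_2$; $V_m^\Omega=V_m\setminus L$; $\Omega_m$ is the graph on $V_m^\Omega$ with adjacency $\sim_m$; its boundary is $\partial\Omega_m=\{q_0\}\cup\{F_wq_0:w\in\{1,2\}^m\}$. A Dirichlet eigenvalue/eigenfunction of $-\Delta_m$ on $\Omega_m$ is $\lambda_m\in\mathbb R$ and a nonzero $u_m:V_m^\Omega\to\mathbb R$ with $u_m=0$ on $\partial\Omega_m$ and $\sum_{y\sim_mx}(u_m(x)-u_m(y))=\lambda_mu_m(x)$ for $x\in V_m^\Omega\setminus\partial\Omega_m$. For a word $w$, $R_w$ is the reflection symmetry of the cell $F_w(\mathcal{SG})$ fixing $F_wq_0$ and exchanging $F_wq_1,F_wq_2$. A Dirichlet eigenfunction $u_m$ on $\Omega_m$ is symmetric (resp. skew-symmetric) primitive if $u_m\circ R_\emptyset=u_m$ (resp. $u_m\circ R_\emptyset=-u_m$) and $u_m\circ R_w=u_m$ on $F_w(\mathcal{SG})\cap V_m^\Omega$ for every nonempty word $w$ in the symbols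 $\{1,2\}$. $\mathcal P_m^+$ (resp. $\mathcal P_m^-$) is the set of eigenvalues of $m$-level symmetric (resp. skew-symmetric) primitive graph eigenfunctions.
   Formalization: Primitive eigenfunctions are also required not to be localized, i.e. not to vanish on all cells F_w(SG) with w in {1,2}^{m-1}; with the symmetry conditions alone the claim fails, since for m=3 a localized symmetric eigenfunction has eigenvalue 6. *)

(* Defs.v *)
From HB Require Import structures.
From mathcomp Require Import all_boot all_order all_algebra finmap.
From mathcomp Require Import all_classical all_reals all_analysis.

Set Implicit Arguments.
Unset Strict Implicit.
Unset Printing Implicit Defensive.

Import Order.TTheory GRing.Theory Num.Theory numFieldNormedType.Exports.

Local Open Scope classical_set_scope.
Local Open Scope ring_scope.

(* The norm of the library on row vectors is the sup norm, so Euclidean lengths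
   and orthogonality are expressed with this inner product. *)
Definition dot (R : realType) (u v : 'rV[R]_2) : R := \sum_k u 0 k * v 0 k.

Definition equilateral (R : realType) (q : 'I_3 -> 'rV[R]_2) : Prop :=
  exists2 d : R, 0 < d &
    forall i j : 'I_3, i != j -> dot (q i - q j) (q i - q j) = d.

Definition F (R : realType) (q : 'I_3 -> 'rV[R]_2) (i : 'I_3) (x : 'rV[R]_2) :
  'rV[R]_2 := 2^-1 *: (x + q i).

Definition Fw (R : realType) (q : 'I_3 -> 'rV[R]_2) (w : seq 'I_3)
  (x : 'rV[R]_2) : 'rV[R]_2 := foldr (F q) x w.

Definition attractor (R : realType) (q : 'I_3 -> 'rV[R]_2)
  (SG : set 'rV[R]_2) : Prop :=
  [/\ compact SG, SG !=set0 & SG = \bigcup_(i in [set: 'I_3]) (F q i @` SG)].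

(* Words in the symbols {1, 2}. *)
Definition word12 (w : seq 'I_3) : bool := all (fun i => i != 0) w.

Definition segL (R : realType) (q : 'I_3 -> 'rV[R]_2) : set 'rV[R]_2 :=
  [set (1 - t) *: q 1 + t *: q 2%:R | t in `[0, 1]%classic].

Definition V (R : realType) (q : 'I_3 -> 'rV[R]_2) (m : nat) :
  {fset 'rV[R]_2} :=
  [fset Fw q (tval w) (q i) | w in {: m.-tuple 'I_3}, i in {: 'I_3}]%fset.

Definition VOmega (R : realType) (q : 'I_3 -> 'rV[R]_2) (m : nat) :
  {fset 'rV[R]_2} :=
  [fset x in V q m | x \notin segL q]%fset.

Definition adj (R : realType) (q : 'I_3 -> 'rV[R]_2) (m : nat) :
  rel 'rV[R]_2 :=
  fun x y => (x != y) && [exists w : m.-tuple 'I_3,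
    [exists i, x == Fw q w (q i)] && [exists j, y == Fw q w (q j)]].

Definition bdOmega (R : realType) (q : 'I_3 -> 'rV[R]_2) (m : nat) :
  pred 'rV[R]_2 :=
  fun x => (x == q 0) ||
    [exists w : m.-tuple 'I_3, word12 w && (x == Fw q w (q 0))].


Definition dirichlet (R : realType) (q : 'I_3 -> 'rV[R]_2) (m : nat)
  (lam : R) (u : {ffun VOmega q m -> R^o}) : Prop :=
  (forall x : VOmega q m, bdOmega q m (val x) -> u x = 0) /\
  (forall x : VOmega q m, ~~ bdOmega q m (val x) ->
     \sum_(y : VOmega q m | adj q m (val x) (val y)) (u x - u y)
     = lam * u x).

(* Orthogonal reflection in the line through F_w q_0 perpendicular to
   F_w q_2 - F_w q_1; the triangle being equilateral, it exchanges F_w q_1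
   and F_w q_2. *)
Definition refl (R : realType) (q : 'I_3 -> 'rV[R]_2) (w : seq 'I_3)
  (x : 'rV[R]_2) : 'rV[R]_2 :=
  let d := Fw q w (q 2%:R) - Fw q w (q 1) in
  x - (2 * dot (x - Fw q w (q 0)) d / dot d d) *: d.

(* Solutions with the symmetries of a symmetric (skew = false) or
   skew-symmetric (skew = true) primitive eigenfunction, including u = 0. *)
Definition prim_sol (R : realType) (q : 'I_3 -> 'rV[R]_2)
  (SG : set 'rV[R]_2) (skew : bool) (m : nat) (lam : R)
  (u : {ffun VOmega q m -> R^o}) : Prop :=
  [/\ dirichlet lam u,
      (forall x y : VOmega q m, val y = refl q [::] (val x) ->
         u y = (-1) ^+ skew * u x)
    & (forall w : seq 'I_3, w != [::] -> word12 w ->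
       forall x y : VOmega q m, (Fw q w @` SG) (val x) ->
         val y = refl q w (val x) -> u y = u x)].

(* Support away from L: u vanishes on the cells of level m - 1 that have an
   edge on L. (On the cells of level m along L, every function satisfying the
   Dirichlet condition vanishes.) *)
Definition localized (R : realType) (q : 'I_3 -> 'rV[R]_2)
  (SG : set 'rV[R]_2) (m : nat) (u : {ffun VOmega q m -> R^o}) : Prop :=
  forall (w : (m.-1).-tuple 'I_3) (x : VOmega q m),
    word12 w -> (Fw q w @` SG) (val x) -> u x = 0.

(* Localized eigenfunctions are a class apart from the primitive ones, but the
   two symmetry conditions alone do not exclude them: for m = 3 they admit
   eigenfunctions with eigenvalue 6 that vanish outside the cell F_0 SG.
   A function that is not localized is in particular nonzero. *)
Definition primitive (R : realType) (q : 'I_3 -> 'rV[R]_2)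
  (SG : set 'rV[R]_2) (skew : bool) (m : nat) (lam : R)
  (u : {ffun VOmega q m -> R^o}) : Prop :=
  prim_sol SG skew lam u /\ ~ localized SG u.

Definition prim_eigenvalues (R : realType) (q : 'I_3 -> 'rV[R]_2)
  (SG : set 'rV[R]_2) (skew : bool) (m : nat) : set R :=
  [set lam | exists u : {ffun VOmega q m -> R^o}, primitive SG skew lam u].

(* The dimension of the whole space of solutions having the symmetries,
   localized ones included. *)
Definition prim_multiplicity (R : realType) (q : 'I_3 -> 'rV[R]_2)
  (SG : set 'rV[R]_2) (skew : bool) (m : nat) (lam : R) (k : nat) : Prop :=
  exists U : {vspace {ffun VOmega q m -> R^o}},
    (forall u, u \in U <-> prim_sol SG skew lam u) /\ \dim U = k.

Definition phim (R : realType) (x : R) : R := (5 - Num.sqrt (25 - 4 * x)) / 2.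
Definition phip (R : realType) (x : R) : R := (5 + Num.sqrt (25 - 4 * x)) / 2.

Definition r_ (m : nat) : nat := (2 ^ m + 2 ^ (m - 2) - 2)%N.
Definition s_ (m : nat) : nat := (2 ^ m - 2)%N.

(* P m and mult m lam k stand for the set of eigenvalues of level m and for
   "lam has multiplicity k at level m", n m for the number of eigenvalues;
   lam m k, 1 <= k <= n m, is then forced to be the increasing enumeration. *)
Definition interlacing_spectrum (R : realType) (P : nat -> set R)
  (mult : nat -> R -> nat -> Prop) (n : nat -> nat) : Prop :=
  exists lam : nat -> nat -> R, forall m : nat, (2 <= m)%N ->
    [/\ [/\ P m = [set lam m k | k in [set k | (1 <= k <= n m)%N]],
            (forall j k, (1 <= j)%N -> (j < k)%N -> (k <= n m)%N ->
               lam m j < lam m k)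
          & (forall k, (1 <= k <= n m)%N -> mult m (lam m k) 1%N)],
        [/\ (forall k, (1 <= k <= n m)%N -> 0 < lam m k < 6),
            0 < lam m 1%N, lam m (n m).-1 < 5, 5 < lam m (n m)
          & lam m (n m) < 6],
        n m.+1 = (2 * n m + 2)%N
      & [/\ 0 < lam m.+1 1%N < phim (lam m 1%N),
            (forall k, (2 <= k <= n m)%N ->
               phim (lam m k.-1) < lam m.+1 k < phim (lam m k)),
            phim (lam m (n m)) < lam m.+1 (n m).+1 < phip (lam m (n m)),
            (forall k, (n m + 2 <= k <= 2 * n m)%N ->
               phip (lam m (2 * n m + 2 - k)%N) < lam m.+1 k
                 < phip (lam m (2 * n m + 1 - k)%N))
          & phip (lam m 1%N) < lam m.+1 (2 * n m + 1)%N < 5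
            /\ 5 < lam m.+1 (2 * n m + 2)%N < 6]].

(* Main.v *)
(* A primitive eigenfunction is, up to signs, a radial object: it is determined by
   its values on the rows [F_w q_0], [|w| = j], and by its restriction to the
   cells [F_w F_0 SG] hanging between two consecutive rows.

   Sturm part. Shoot from [q_0] downwards, keeping the value [A] and a suitably
   normalized flux [e] on the last row. Spectral decimation turns this pair at
   [decim x = x (5 - x)] into the pair of the next level at [x] by the
   polynomial map [step], and the eigenvalues are the roots of [A]. If [e]
   alternates in sign at the roots of [A], then the next [A] alternates in sign
   at [0], the [phim] and [phip] of the old roots, [5] and [6]; these are as many
   sign changes as its degree allows, and [e] alternates again at the new roots.

   Linear algebra part. Whether a given real [lam] is an eigenvalue is decided
   by shooting from the bottom row upwards, where a cell enters only through its
   Dirichlet-to-Neumann relation; a discrete Wronskian links the two shootings.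
   The relation degenerates when an iterate [x_k] of [lam] under [decim] is [5],
   when [x_k = 3], or when [lam = 6]; every solution with such a parameter is
   localized, so it remains to see that they are not roots of [A]. For [3] there
   is an invariant of [step]; for [5] a 5-adic argument: the constant
   coefficients of the polynomials involved are prime to [5], and so are those
   of their norms down to [Z[5] = Z]. *)

Require Import Defs.
From mathcomp Require Import all_boot all_order all_algebra finmap polyrcf.
From mathcomp Require Import all_classical all_reals all_analysis.
From mathcomp Require Import ring lra zify.

Set Implicit Arguments.
Unset Strict Implicit.
Unset Printing Implicit Defensive.

Import Order.TTheory GRing.Theory Num.Theory numFieldNormedType.Exports.

Local Open Scope ring_scope.

(** * Sturm sequences under spectral decimation *)

Lemma incr_lt (R : realFieldType) (g : nat -> R) (a b : nat) :
  (forall k, (a <= k < b)%N -> g k < g k.+1) ->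
  forall i j, (a <= i)%N -> (i < j)%N -> (j <= b)%N -> g i < g j.
Proof.
move=> gS i j ai; elim: j => [//|j IHj]; rewrite ltnS leq_eqVlt => /orP[/eqP <- ib|ij jb].
  by apply: gS; rewrite ai.
apply: lt_trans (IHj ij (ltnW jb)) (gS j _).
by rewrite jb (leq_trans ai (ltnW ij)).
Qed.

Lemma prod_sub_sign (R : realFieldType) (g : nat -> R) (N k : nat) (y : R) :
  (1 <= k <= N.+1)%N ->
  (forall i, (1 <= i < k)%N -> g i < y) ->
  (forall i, (k <= i <= N)%N -> y < g i) ->
  0 < (-1) ^+ k.-1 * \prod_(1 <= i < N.+1) (g i - y).
Proof.
move=> /andP[k1 kN] lo hi.
rewrite (big_cat_nat k1 kN) /= mulrA.
have -> : (-1) ^+ k.-1 = \prod_(1 <= i < k) (-1 : R).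
  by rewrite prodr_const_nat subn1.
rewrite -big_split /=; apply: mulr_gt0; rewrite big_nat_cond; apply: prodr_gt0 => i;
  rewrite andbT => Hi.
  by rewrite mulN1r opprB subr_gt0 lo.
by rewrite subr_gt0 hi.
Qed.

(** The sign changes give a root in each of the [N] gaps, and the degree bound leaves room for no
    other. With factors written [l k - y] the constant is positive, because [P] is positive at
    [g 0], left of all the roots. *)
Lemma alternating_roots (R : rcfType) (N : nat) (P : {poly R}) (g : nat -> R) :
  (size P <= N.+1)%N -> (forall k, (k < N)%N -> g k < g k.+1) ->
  (forall k, (k <= N)%N -> 0 < (-1) ^+ k * P.[g k]) ->
  exists l : nat -> R, exists2 c, 0 < c &
    (forall k, (1 <= k <= N)%N -> g k.-1 < l k < g k) /\
    (forall y, P.[y] = c * \prod_(1 <= k < N.+1) (l k - y)).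
Proof.
move=> sP gS sgn.
have /choice[l Hl] : forall k, exists x,
    (1 <= k <= N)%N -> (g k.-1 < x < g k) && root P x.
  case=> [|k]; first by exists 0.
  case: (leqP k.+1 N) => kN; last by exists 0; rewrite andbF.
  have [||x] := @poly_ivtoo R P (g k) (g k.+1); first exact/ltW/gS.
    have := mulr_gt0 (sgn _ (ltnW kN)) (sgn _ kN).
    rewrite exprS mulN1r mulNr mulrN mulrACA -expr2 sqrr_sign mul1r.
    by rewrite oppr_gt0.
  by rewrite in_itv /= => Hx rx; exists x; rewrite Hx rx.
have lb k : (1 <= k <= N)%N -> g k.-1 < l k < g k by move=> /Hl /andP[].
have lr k : (1 <= k <= N)%N -> root P (l k) by move=> /Hl /andP[].
have lS k : (1 <= k < N)%N -> l k < l k.+1.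
  move=> /andP[k1 kN]; have /andP[_ H1] : g k.-1 < l k < g k by apply: lb; lia.
  have /andP[H2 _] : g k.+1.-1 < l k.+1 < g k.+1 by apply: lb; lia.
  exact: lt_trans H1 H2.
have linc := incr_lt lS.
have P0 : P != 0.
  apply/eqP => P0; have := sgn 0 isT; rewrite P0 horner0 mulr0 ltxx //.
set rs := [seq l k | k <- index_iota 1 N.+1].
have srs : size rs = N by rewrite size_map size_iota subn1.
have urs : uniq rs.
  rewrite map_inj_in_uniq ?iota_uniq // => i j; rewrite !mem_index_iota !ltnS => Hi Hj e.
  case: (ltngtP i j) => // ij.
    by have := linc i j; rewrite e ltxx; lia.
  by have := linc j i; rewrite e ltxx; lia.
have ars : all (root P) rs.
  by apply/allP => x /mapP[k]; rewrite mem_index_iota ltnS => /lr rk ->.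
have sPN : size P = (size rs).+1.
  by apply/eqP; rewrite eqn_leq srs sP -srs max_poly_roots.
have fac y : P.[y] = lead_coef P * (-1) ^+ N * \prod_(1 <= k < N.+1) (l k - y).
  rewrite {1}(all_roots_prod_XsubC sPN ars _) ?uniq_rootsE // hornerZ -mulrA; congr (_ * _).
  rewrite big_map horner_prod.
  have -> : (-1) ^+ N = \prod_(1 <= i < N.+1) (-1 : R) by rewrite prodr_const_nat subn1.
  rewrite -big_split /=; apply: eq_bigr => i _; rewrite !hornerE; ring.
exists l, (lead_coef P * (-1) ^+ N); last by [].
have := sgn 0 isT; rewrite expr0 mul1r fac; rewrite pmulr_lgt0 //.
rewrite big_nat_cond; apply: prodr_gt0 => i; rewrite andbT ltnS => Hi.
have /andP[H _] := lb i Hi; rewrite subr_gt0; apply: le_lt_trans H.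
have [->//|i1] := posnP i.-1; apply/ltW.
by apply: (@incr_lt _ g 0 N) => //; lia.
Qed.

(** * Decimation polynomial, inverse branches and interlacing grid *)

Definition decim (R : realFieldType) (x : R) : R := x * (5 - x).

(* One level of spectral decimation for the pair (value, flux) of the solution
   shot from q_0 downwards: [p] is the pair of one level at the parameter
   [decim x], the result is the pair of the next level at [x]. *)
Definition step (R : realFieldType) (x : R) (p : R * R) : R * R :=
  ((4 - x) * (5 - x) * p.1 + (6 - x) * (3 - x) * p.2,
   - decim x * p.1 + (6 - decim x) * p.2).

Definition stepf (R : realFieldType) (F : R -> R * R) (x : R) : R * R :=
  step x (F (decim x)).

(* The points between which the eigenvalues of the next level are located. *)
Definition grid (R : realType) (n : nat) (l : nat -> R) (k : nat) : R :=
  if k == 0%N then 0 else if (k <= n)%N then phim (l k)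
  else if (k <= 2 * n)%N then phip (l (2 * n + 1 - k)%N)
  else if k == (2 * n + 1)%N then 5 else 6.

(** The invariant carried from level to level. The roots being positive, the first clause makes the
    value positive for all [y <= 0]; the flux at 0 is recorded because [decim] sends the grid point
    5 to 0. *)
Definition sturm (R : realType) (n : nat) (F : R -> R * R) (l : nat -> R) :=
  [/\ exists2 c, 0 < c & forall y, (F y).1 = c * \prod_(1 <= k < n.+1) (l k - y),
      exists2 E : {poly R}, (size E <= n.+1)%N & forall y, (F y).2 = E.[y],
      (forall k, (1 <= k < n)%N -> l k < l k.+1) /\
      (forall k, (1 <= k <= n)%N -> 0 < l k < 6),
      forall k, (1 <= k <= n)%N -> 0 < (-1) ^+ k * (F (l k)).2
    & 0 < (F 0).2].

Lemma phiD (R : realType) (x : R) : phim x + phip x = 5.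
Proof. by rewrite /phim /phip; field. Qed.

Lemma phiM (R : realType) (x : R) : x < 6 -> phim x * phip x = x.
Proof.
move=> x6; have : Num.sqrt (25 - 4 * x) ^+ 2 = 25 - 4 * x by rewrite sqr_sqrtr; lra.
by rewrite /phim /phip; move: (Num.sqrt _) => s hs; nra.
Qed.

Lemma decim_phim (R : realType) (x : R) : x < 6 -> decim (phim x) = x.
Proof. by move=> x6; rewrite /decim -(phiD x) addrC addKr phiM. Qed.

Lemma decim_phip (R : realType) (x : R) : x < 6 -> decim (phip x) = x.
Proof. by move=> x6; rewrite /decim -(phiD x) addrK mulrC phiM. Qed.

Lemma sub_decim (R : realType) (x y : R) : x < 6 ->
  x - decim y = (phim x - y) * (phip x - y).
Proof.
move=> x6; rewrite -{1}(phiM x6) /decim -(phiD x); ring.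
Qed.

Lemma phim_lt (R : realType) (x y : R) : x < y -> y < 6 -> phim x < phim y.
Proof.
move=> xy y6; rewrite /phim ltr_pM2r ?invr_gt0 // ltrD2l ltrN2.
by rewrite ltr_sqrt; lra.
Qed.

Lemma phip_lt (R : realType) (x y : R) : x < y -> y < 6 -> phip y < phip x.
Proof. by move=> xy y6; have := phim_lt xy y6; have := phiD x; have := phiD y; lra. Qed.

Lemma phim_bound (R : realType) (x : R) : 0 < x < 6 -> 0 < phim x < 2.
Proof.
move=> /andP[x0 x6].
have s0 : phim (0 : R) = 0.
  rewrite /phim mulr0 subr0 (_ : 25 = 5 ^+ 2 :> R) ?sqrtr_sqr ?ger0_norm ?subrr ?mul0r //.
  by rewrite expr2; lra.
rewrite -[X in X < _]s0 phim_lt //= /phim.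
have : 1 < Num.sqrt (25 - 4 * x) by rewrite -[X in X < _]sqrtr1 ltr_sqrt; lra.
by lra.
Qed.

Lemma phip_bound (R : realType) (x : R) : 0 < x < 6 -> 3 < phip x < 5.
Proof. by move=> /phim_bound; have := phiD x; lra. Qed.

Lemma grid0 (R : realType) (n : nat) (l : nat -> R) : grid n l 0 = 0.
Proof. by []. Qed.

Lemma grid_phim (R : realType) (n : nat) (l : nat -> R) (k : nat) :
  (1 <= k <= n)%N -> grid n l k = phim (l k).
Proof. by case/andP => k0 kn; rewrite /grid kn; case: k k0 {kn}. Qed.

Lemma grid_phip (R : realType) (n : nat) (l : nat -> R) (k : nat) :
  (n < k <= 2 * n)%N -> grid n l k = phip (l (2 * n + 1 - k)%N).
Proof.
case/andP => nk k2n; rewrite /grid k2n leqNgt nk /=.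
by case: k nk {k2n}.
Qed.

Lemma grid5 (R : realType) (n : nat) (l : nat -> R) : grid n l (2 * n + 1) = 5.
Proof.
rewrite /grid eqxx.
have -> : (2 * n + 1 == 0)%N = false by lia.
have -> : (2 * n + 1 <= n)%N = false by lia.
by have -> : (2 * n + 1 <= 2 * n)%N = false by lia.
Qed.

Lemma grid6 (R : realType) (n : nat) (l : nat -> R) : grid n l (2 * n + 2) = 6.
Proof.
rewrite /grid.
have -> : (2 * n + 2 == 0)%N = false by lia.
have -> : (2 * n + 2 <= n)%N = false by lia.
have -> : (2 * n + 2 <= 2 * n)%N = false by lia.
by have -> : (2 * n + 2 == 2 * n + 1)%N = false by lia.
Qed.

Lemma grid_lt (R : realType) (n : nat) (l : nat -> R) :
  (forall k, (1 <= k < n)%N -> l k < l k.+1) ->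
  (forall k, (1 <= k <= n)%N -> 0 < l k < 6) ->
  forall k, (k < 2 * n + 2)%N -> grid n l k < grid n l k.+1.
Proof.
move=> lS lb k kn.
have [k5|k5] := eqVneq k (2 * n + 1)%N.
  by rewrite k5 grid5 (_ : (2 * n + 1).+1 = (2 * n + 2)%N) ?grid6; [lra|lia].
have [k4|k4] := eqVneq k (2 * n)%N.
  rewrite k4 (_ : (2 * n).+1 = (2 * n + 1)%N) ?grid5; last by lia.
  have [n0|n0] := posnP n; first by rewrite n0 grid0; lra.
  rewrite grid_phip; last by lia.
  by have /andP[] : 3 < phip (l (2 * n + 1 - 2 * n)%N) < 5 by apply/phip_bound/lb; lia.
have [->|k0] := posnP k.
  by rewrite grid0 grid_phim; [have /andP[] := phim_bound (lb 1%N ltac:(lia))|lia].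
case: (ltngtP k n) => kn'.
- rewrite !grid_phim; [|lia..].
  by apply: phim_lt; [apply: lS; lia | case/andP: (lb k.+1 ltac:(lia))].
- rewrite !grid_phip; [|lia..].
  have -> : (2 * n + 1 - k = (2 * n + 1 - k.+1).+1)%N by lia.
  apply: phip_lt; first by apply: lS; lia.
  by have /andP[] : 0 < l (2 * n + 1 - k.+1).+1 < 6 by apply: lb; lia.
- rewrite grid_phim ?grid_phip; [|lia..].
  have := phim_bound (lb k ltac:(lia)).
  by have := phip_bound (lb (2 * n + 1 - k.+1)%N ltac:(lia)); lra.
Qed.

(** Each old root contributes its two preimages, and [5 - y] supplies the remaining grid point
    between 0 and 6. The branch [phip] reverses the order. *)
Lemma prod_decim (R : realType) (n : nat) (l : nat -> R) (y : R) :
  (forall k, (1 <= k <= n)%N -> l k < 6) ->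
  \prod_(1 <= k < n.+1) (l k - decim y) * (5 - y) =
  \prod_(1 <= k < (2 * n + 1).+1) (grid n l k - y).
Proof.
move=> l6.
rewrite [RHS]big_nat_recr /=; last by lia.
congr (_ * _); last first.
  by rewrite grid5.
rewrite [RHS](@big_cat_nat _ _ _ n.+1) /=; [|lia..].
have -> : \prod_(1 <= k < n.+1) (l k - decim y) =
  \prod_(1 <= k < n.+1) (phim (l k) - y) * \prod_(1 <= k < n.+1) (phip (l k) - y).
  rewrite -big_split /=; apply: eq_big_nat => i; rewrite ltnS => Hi.
  by rewrite sub_decim // l6.
congr (_ * _).
  by apply: eq_big_nat => i Hi; rewrite grid_phim.
have -> : \prod_(n.+1 <= i < 2 * n + 1) (grid n l i - y) =
    \prod_(1 <= i < n.+1) (grid n l (i + n) - y).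
  by rewrite -{1}(add1n n) big_addn (_ : (2 * n + 1 - n = n.+1)%N) //; lia.
rewrite big_nat_rev /=; apply: eq_big_nat => i Hi; rewrite grid_phip; last by lia.
by congr (phip (l _) - _); lia.
Qed.

Lemma sturm_poly (R : realType) (n : nat) (F : R -> R * R) (l : nat -> R) :
  sturm n F l ->
  exists2 P : {poly R}, (size P <= n.+1)%N & forall y, (F y).1 = P.[y].
Proof.
case=> -[c _ Fc] _ _ _ _.
exists (c *: \prod_(k <- index_iota 1 n.+1) ((l k)%:P - 'X)).
  apply: leq_trans (size_scale_leq _ _) _.
  have {2}-> : n.+1 = (size (index_iota 1 n.+1)).+1 by rewrite size_iota subn1.
  elim: (index_iota _ _) => [|k s IHs]; first by rewrite big_nil size_poly1.
  rewrite big_cons; apply: leq_trans (size_polyMleq _ _) _.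
  have -> : (l k)%:P - 'X = - ('X - (l k)%:P) by rewrite opprB.
  by rewrite size_polyN size_XsubC ltnS.
by move=> y; rewrite Fc hornerZ horner_prod; under [in RHS]eq_bigr do rewrite !hornerE.
Qed.

Lemma size_quad_comp (R : idomainType) (n : nat) (q d p : {poly R}) :
  (size q <= 3)%N -> (size d <= 3)%N -> (size p <= n.+1)%N ->
  (size (q * (p \Po d))%R <= (2 * n + 2).+1)%N.
Proof.
move=> sq sd sp; apply: leq_trans (size_polyMleq _ _) _.
have h1 := size_comp_poly_leq p d.
have h2 : ((size p).-1 * (size d).-1 <= n * 2)%N by apply: leq_mul; lia.
by lia.
Qed.

Lemma sturm_step (R : realType) (n : nat) (F : R -> R * R) (l : nat -> R) :
  sturm n F l ->
  exists2 l', sturm (2 * n + 2) (stepf F) l' &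
    forall k, (1 <= k <= 2 * n + 2)%N -> grid n l k.-1 < l' k < grid n l k.
Proof.
move=> stF; have [PA sPA AE] := sturm_poly stF.
case: (stF) => -[c c0 Fc] [E sE EE] [lS lb] esgn e0.
have gS := grid_lt lS lb.
pose d : {poly R} := Poly [:: 0; 5; -1].
have sd : (size d <= 3)%N by exact: size_Poly.
have dE y : d.[y] = decim y by rewrite horner_Poly /= /decim; ring.
pose P := Poly [:: 20; -9; 1] * (PA \Po d) + Poly [:: 18; -9; 1] * (E \Po d).
pose E' := (- d) * (PA \Po d) + Poly [:: 6; -5; 1] * (E \Po d).
have PE y : P.[y] = (stepf F y).1.
  rewrite /P hornerD !hornerM !horner_comp dE -AE -EE !horner_Poly /=; ring.
have E'E y : E'.[y] = (stepf F y).2.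
  rewrite /E' hornerD !hornerM hornerN !horner_comp dE -AE -EE horner_Poly /= /decim; ring.
have sP : (size P <= (2 * n + 2).+1)%N.
  apply: leq_trans (size_polyD _ _) _.
  by rewrite geq_max !size_quad_comp // size_Poly.
have sE' : (size E' <= (2 * n + 2).+1)%N.
  apply: leq_trans (size_polyD _ _) _.
  by rewrite geq_max !size_quad_comp ?size_Poly // size_polyN.
have A_pos y : y <= 0 -> 0 < (F y).1.
  move=> y0; rewrite Fc mulr_gt0 // big_nat_cond; apply: prodr_gt0 => i.
  by rewrite andbT ltnS => /lb /andP[li _]; lra.
have A_root k : (1 <= k <= n)%N -> (F (l k)).1 = 0.
  move=> Hk; rewrite Fc (bigD1_seq k) ?iota_uniq ?mem_index_iota //=.
  by rewrite subrr mul0r mulr0.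
(* At 0 both terms are positive; at 5 only the flux term survives, taken at [decim 5 = 0], and at 6
   only the value term, taken at -6. At a preimage of an old root the value term drops out, and the
   factor $(6-x)(3-x)$ is positive on the branch [phim], below 2, and negative on [phip], between 3
   and 5. *)
have sgn k : (k <= 2 * n + 2)%N -> 0 < (-1) ^+ k * P.[grid n l k].
  move=> kn; rewrite PE /stepf /step /=.
  have [->|k6] := eqVneq k (2 * n + 2)%N.
    rewrite grid6 (_ : 2 * n + 2 = n.+1 * 2)%N; last by lia.
    rewrite mulnC exprM sqrrN expr1n expr1n (_ : decim 6 = -6); last by rewrite /decim; ring.
    have := A_pos (-6) ltac:(lra).
    by move: (F _).1 => a; rewrite [6 - 6]subrr !mul0r addr0; lra.
  have [->|k5] := eqVneq k (2 * n + 1)%N.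
    rewrite grid5 addn1 exprS exprM sqrrN expr1n expr1n /decim subrr !mulr0.
    by move: (F 0).1 (F 0).2 e0 => a e; lra.
  have [->|k0] := posnP k.
    rewrite grid0 /decim mul0r.
    have := A_pos 0 (lexx 0).
    by move: (F 0).1 (F 0).2 e0 => a e; lra.
  case: (leqP k n) => kn'.
    have Hk : (1 <= k <= n)%N by lia.
    have /andP[_ l6] := lb k Hk.
    rewrite grid_phim // decim_phim // A_root // mulr0 add0r mulrCA.
    by have := phim_bound (lb k Hk) => b; rewrite mulr_gt0 ?esgn //; nra.
  have Hk : (1 <= 2 * n + 1 - k <= n)%N by lia.
  have /andP[_ l6] := lb _ Hk.
  rewrite grid_phip; last by lia.
  rewrite decim_phip // A_root // mulr0 add0r mulrCA.
  have -> : (-1) ^+ k = - (-1) ^+ (2 * n + 1 - k) :> R.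
    apply: (@mulfI _ ((-1) ^+ (2 * n + 1 - k))); first by rewrite signr_eq0.
    rewrite mulrN -expr2 sqrr_sign -exprD subnK; last by lia.
    by rewrite addn1 exprS exprM sqrrN expr1n expr1n mulr1.
  have := phip_bound (lb _ Hk); have := esgn _ Hk.
  move: (_ ^+ _) (F _).2 (phip _) => s e p se b; rewrite mulNr mulrN -mulNr mulr_gt0 //.
  by nra.
have [l' [c' c'0 [lb' fac]]] := alternating_roots sP gS sgn.
have bnd k : (1 <= k <= 2 * n + 2)%N -> 0 < l' k < 6.
  move=> Hk; have /andP[h1 h2] := lb' k Hk.
  have gi := @incr_lt _ (grid n l) 0 (2 * n + 2) gS.
  apply/andP; split.
    apply: le_lt_trans h1; rewrite -(grid0 n l).
    by have [->//|k1] := posnP k.-1; apply/ltW/gi; lia.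
  apply: lt_le_trans h2 _; rewrite -(grid6 n l).
  have [->//|k1] := eqVneq k (2 * n + 2)%N.
  by apply/ltW/gi; lia.
have l'S k : (1 <= k < 2 * n + 2)%N -> l' k < l' k.+1.
  move=> Hk; have /andP[_ H1] : grid n l k.-1 < l' k < grid n l k by apply: lb'; lia.
  have /andP[H2 _] : grid n l k.+1.-1 < l' k.+1 < grid n l k.+1 by apply: lb'; lia.
  exact: lt_trans H1 H2.
exists l' => //; split.
- by exists c' => // y; rewrite -PE.
- by exists E' => // y; rewrite E'E.
- by split.
- move=> k Hk.
  have /andP[h1 h2] := lb' k Hk; have /andP[b1 b2] := bnd k Hk.
  have r0 : (stepf F (l' k)).1 = 0.
    rewrite -PE fac (bigD1_seq k) ?iota_uniq ?mem_index_iota ?ltnS //=.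
    by rewrite subrr mul0r mulr0.
  (* The old flux is eliminated between the two components of [step]. At a new root the new flux is
     thus a negative multiple of the old value times $5-x$, a product over the grid whose sign is
     known from the position of the root. *)
  have rel : (6 - l' k) * (stepf F (l' k)).2
      = - (8 * ((F (decim (l' k))).1 * (5 - l' k))).
    transitivity ((2 - l' k) * (stepf F (l' k)).1
      - 8 * ((F (decim (l' k))).1 * (5 - l' k))).
      by rewrite /stepf /step /= /decim; ring.
    by rewrite r0 mulr0 add0r.
  have gi := @incr_lt _ (grid n l) 0 (2 * n + 2) gS.
  have : 0 < (-1) ^+ k.-1 * ((F (decim (l' k))).1 * (5 - l' k)).
    rewrite Fc -mulrA prod_decim; last by move=> i /lb /andP[].
    rewrite mulrCA mulr_gt0 // prod_sub_sign //; first by lia.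
      move=> i Hi; apply: le_lt_trans h1.
      have [->//|ik] := eqVneq i k.-1.
      by apply/ltW/gi; lia.
    move=> i Hi; apply: lt_le_trans h2 _.
    have [->//|ik] := eqVneq i k.
    by apply/ltW/gi; lia.
  have -> : (-1) ^+ k = - (-1) ^+ k.-1 :> R.
    by rewrite -{1}(@prednK k) ?exprS ?mulN1r //; lia.
  move: ((-1) ^+ _) rel => s; set X := _ * (5 - _); set e := _.2 => rel sX.
  rewrite -(@pmulr_rgt0 _ (6 - l' k)) ?subr_gt0 //.
  have -> : (6 - l' k) * (- s * e) = 8 * (s * X).
    by transitivity (- s * ((6 - l' k) * e)); [ring|rewrite rel; ring].
  by rewrite mulr_gt0.
- rewrite /stepf /step /= /decim mul0r oppr0 mul0r add0r addr0.
  by rewrite mulr_gt0.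
Qed.

Definition skew_init (R : realFieldType) (x : R) : R * R := (1, 1).

(* At level 1 the symmetric pair would be [(6 - x, 2 - x)], whose image under
   [step] has the spurious factor [3 - x]; hence the start at level 2. *)
Definition sym_init (R : realFieldType) (x : R) : R * R :=
  (26 - 35 * x + 11 * x ^+ 2 - x ^+ 3, (2 - x) * (1 - decim x)).

Lemma sturm_skew (R : realType) : sturm 0 (@skew_init R) (fun=> 0).
Proof.
split=> //=.
- by exists 1 => // y; rewrite big_nil mulr1.
- by exists 1 => [|y]; rewrite ?size_poly1 ?hornerC.
- by split=> -[|k].
- by case.
Qed.

(** The cubic takes the values 26, -8, 1, -4 at 0, 2, 5, 6. At a root [x] the flux is
    $-4(2-x)(5-x)/(6-x)$, so its sign follows from the interval containing the root. *)
Lemma sturm_sym (R : realType) :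
  exists2 l, sturm 3 (@sym_init R) l & l 2 < 5 < l 3%N.
Proof.
pose g k : R := nth 0 [:: 0; 2; 5; 6] k.
pose P : {poly R} := Poly [:: 26; -35; 11; -1].
have PE y : P.[y] = (sym_init y).1 by rewrite horner_Poly /=; ring.
have gS k : (k < 3)%N -> g k < g k.+1.
  by case: k => [|[|[|k]]] //= _; rewrite /g /=; lra.
have sgn k : (k <= 3)%N -> 0 < (-1) ^+ k * P.[g k].
  by case: k => [|[|[|[|k]]]] //= _; rewrite PE /g /= !exprS expr0; lra.
have [l [c c0 [lb fac]]] := alternating_roots (size_Poly _ : (size P <= 4)%N) gS sgn.
have /andP[a1 b1] : 0 < l 1%N < 2 by exact: (lb 1%N).
have /andP[a2 b2] : 2 < l 2 < 5 by exact: (lb 2%N).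
have /andP[a3 b3] : 5 < l 3%N < 6 by exact: (lb 3%N).
exists l; last by rewrite b2 a3.
have root k : (1 <= k <= 3)%N -> (sym_init (l k)).1 = 0.
  move=> Hk; rewrite -PE fac (bigD1_seq k) ?iota_uniq ?mem_index_iota //=.
  by rewrite subrr mul0r mulr0.
split.
- by exists c => // y; rewrite -PE fac.
- exists (Poly [:: 2; -11; 7; -1]); first exact: size_Poly.
  by move=> y; rewrite horner_Poly /= /decim; ring.
- split=> -[|[|[|[|k]]]] //= _; first exact: lt_trans a2; first exact: lt_trans a3.
  + by rewrite a1 (lt_trans b1) //; lra.
  + by apply/andP; split; lra.
  + by apply/andP; split; lra.
- move=> k Hk; have := root k Hk.
  have rel : (6 - l k) * (sym_init (l k)).2 =
      (2 - l k) * (sym_init (l k)).1 - 4 * (2 - l k) * (5 - l k).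
    by rewrite /= /decim; ring.
  move: rel => /[swap] ->; rewrite mulr0 add0r.
  case: k Hk => [|[|[|[|k]]]] //= _; rewrite !exprS expr0 => H; nra.
- by rewrite /= /decim; lra.
Qed.

Lemma sturm_root (R : realType) (n : nat) (F : R -> R * R) (l : nat -> R) (x : R) :
  sturm n F l -> (F x).1 = 0 <-> exists2 k, (1 <= k <= n)%N & x = l k.
Proof.
case=> -[c c0 Fc] _ _ _ _; rewrite Fc; split=> [/eqP|[k Hk ->]].
  rewrite mulf_eq0 gt_eqF //= => /eqP.
  have [[k Hk ->] _|H /eqP] := pselect (exists2 k, (1 <= k <= n)%N & x = l k).
    by exists k.
  rewrite prodf_seq_eq0 => /hasP[k]; rewrite mem_index_iota ltnS /= => Hk.
  by rewrite subr_eq0 => /eqP lx; exists k.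
rewrite (bigD1_seq k) ?iota_uniq ?mem_index_iota ?ltnS //=.
by rewrite subrr mul0r mulr0.
Qed.

Lemma interlacing_of_sturm (R : realType) (P : nat -> set R)
    (mult : nat -> R -> nat -> Prop) (n : nat -> nat) (F : nat -> R -> R * R) :
  (forall m, (2 <= m)%N -> F m.+1 = stepf (F m)) ->
  (forall m, (2 <= m)%N -> n m.+1 = 2 * n m + 2)%N ->
  (2 <= n 2%N)%N ->
  (exists2 l, sturm (n 2%N) (F 2%N) l & l (n 2%N).-1 < 5 < l (n 2%N)) ->
  (forall m, (2 <= m)%N -> forall x, P m x <-> (F m x).1 = 0) ->
  (forall m, (2 <= m)%N -> forall x, (F m x).1 = 0 -> mult m x 1%N) ->
  interlacing_spectrum P mult n.
Proof.
move=> FS nS n2 [l0 st0 l05] PF Fmult.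
have nge m : (2 <= m)%N -> (2 <= n m)%N.
  elim: m => [//|[//|m] IHm] _; have [->//|m0] := posnP m.
  by rewrite nS; lia.
pose good m (l : nat -> R) := sturm (n m) (F m) l /\ l (n m).-1 < 5 < l (n m).
pose inter m (l l' : nat -> R) := forall k, (1 <= k <= n m.+1)%N ->
  grid (n m) l k.-1 < l' k < grid (n m) l k.
(* A state is a level with an enumeration, so that a single dependent choice yields compatible
   enumerations at all levels. The condition [good] inside [rel] keeps the relation total. *)
pose rel (a b : nat * (nat -> R)) := b.1 = a.1.+1 /\
  ((2 <= a.1)%N -> good a.1 a.2 -> good b.1 b.2 /\ inter a.1 a.2 b.2).
have [a|f [f0 fS]] := @dependent_choice _ rel _ (2%N, l0).
  apply: cid; have [[m2 [st l5]]|H] := pselect ((2 <= a.1)%N /\ good a.1 a.2); last first.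
    by exists (a.1.+1, a.2); split=> // h1 h2; case: H.
  have [l' st' gl] := sturm_step st.
  exists (a.1.+1, l'); split=> // _ _; split; last first.
    by move=> k; rewrite /= nS // => Hk; exact: gl.
  rewrite /good /= nS // FS //; split=> //.
  have /andP[_ h1] := gl (2 * n a.1 + 1)%N ltac:(lia).
  have /andP[h2 _] := gl (2 * n a.1 + 2)%N ltac:(lia).
  move: h1 h2; rewrite grid5 (_ : (2 * n a.1 + 2).-1 = 2 * n a.1 + 1)%N; last by lia.
  by rewrite grid5 => -> ->.
have f1 k : (f k).1 = k.+2.
  by elim: k => [|k IHk]; rewrite ?f0 //; case: (fS k) => ->; rewrite IHk.
have fgood k : good k.+2 (f k).2.
  elim: k => [|k IHk]; first by rewrite f0; split.
  by case: (fS k); rewrite !f1 => _ /(_ isT IHk)[].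
have finter k : inter k.+2 (f k).2 (f k.+1).2.
  by case: (fS k); rewrite !f1 => _ /(_ isT (fgood k))[].
exists (fun m => (f (m - 2)%N).2) => m m2.
have {f0 fS fgood finter f1} : good m (f (m - 2)%N).2 /\ (good m.+1 (f (m.+1 - 2)%N).2 /\
    inter m (f (m - 2)%N).2 (f (m.+1 - 2)%N).2).
  have := fgood (m - 2)%N; have := finter (m - 2)%N; have := fgood (m.+1 - 2)%N.
  rewrite (_ : (m.+1 - 2).+2 = m.+1); last by lia.
  rewrite (_ : (m - 2).+2 = m); last by lia.
  by rewrite (_ : (m - 2).+1 = m.+1 - 2)%N; last by lia.
move: (f _).2 (f _).2 => l' l [] [st l5] [[st' l5'] gl].
have nm := nge m m2.
case: (st) => _ _ [lS lb] _ _; case: (st') => _ _ [lS' lb'] _ _.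
have linc := incr_lt lS.
split.
- split.
  + rewrite predeqE => x; rewrite PF // (sturm_root _ st); split=> -[k Hk e]; exists k => //.
  + by move=> j k j1 jk kn; apply: linc.
  + by move=> k Hk; apply: Fmult => //; apply/(sturm_root _ st); exists k.
- split=> //; rewrite ?(andP l5).1 ?(andP l5).2 //.
  + by have /andP[] := lb 1%N ltac:(lia).
  + by have /andP[] := lb (n m) ltac:(lia).
- exact: nS.
have nm1 := nS _ m2.
have gl' k : (1 <= k <= 2 * n m + 2)%N -> grid (n m) l k.-1 < l' k < grid (n m) l k.
  by rewrite -nm1; exact: gl.
split.
- have := gl' 1%N ltac:(lia); rewrite grid0 grid_phim //; lia.
- move=> k Hk; have := gl' k ltac:(lia).
  by rewrite !grid_phim //; lia.
- have := gl' (n m).+1 ltac:(lia); rewrite /= grid_phim ?grid_phip; [|lia..].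
  by rewrite (_ : 2 * n m + 1 - (n m).+1 = n m)%N //; lia.
- move=> k Hk; have := gl' k ltac:(lia).
  rewrite !grid_phip; [|lia..].
  by rewrite (_ : 2 * n m + 1 - k.-1 = 2 * n m + 2 - k)%N //; lia.
split.
- have := gl' (2 * n m + 1)%N ltac:(lia); rewrite grid5 grid_phip; last by lia.
  by rewrite (_ : 2 * n m + 1 - (2 * n m + 1).-1 = 1)%N //; lia.
- have := gl' (2 * n m + 2)%N ltac:(lia); rewrite grid6.
  by rewrite (_ : (2 * n m + 2).-1 = 2 * n m + 1)%N ?grid5 //; lia.
Qed.

(** * Parameters at which the recursion degenerates *)

(** The recursion at a fixed final parameter, run along the orbit of [x] backwards from its [n]-th
    iterate; unlike in [stepf], the initial pair is free. *)
Fixpoint descend (R : realFieldType) (n : nat) (x : R) (p : R * R) : R * R :=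
  if n is k.+1 then descend k x (step (iter k (@decim R) x) p) else p.

Lemma iter_stepf (R : realFieldType) (k : nat) (F : R -> R * R) (x : R) :
  iter k (@stepf R) F x = descend k x (F (iter k (@decim R) x)).
Proof. by elim: k F => [//|k IHk] F; rewrite iterSr IHk. Qed.

Lemma descendS (R : realFieldType) (n : nat) (x : R) (p : R * R) :
  descend n.+1 x p = step x (descend n (decim x) p).
Proof.
elim: n p => [//|n IHn] p; rewrite -[LHS]/(descend n.+1 x (step (iter n.+1 (@decim R) x) p)).
by rewrite IHn [in RHS]/= -iterSr.
Qed.

Lemma descendZ (R : realFieldType) (n : nat) (x c : R) (p : R * R) :
  descend n x (c * p.1, c * p.2) = (c * (descend n x p).1, c * (descend n x p).2).
Proof.
elim: n p => [//|n IHn] p /=; rewrite -IHn; congr (descend _ _ (_, _)) => /=; ring.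
Qed.

Lemma decim_neg (R : realFieldType) (x : R) : x < 0 -> decim x < 0.
Proof. by rewrite /decim => x0; nra. Qed.

Lemma iter_decim_neg (R : realFieldType) (n : nat) (x : R) :
  x < 0 -> iter n (@decim R) x < 0.
Proof. by move=> x0; elim: n => //= n; exact: decim_neg. Qed.

(* The relation [x * A = (2 - x) * e] is preserved by [step]. *)
Lemma descend3_neq0 (R : realFieldType) (n : nat) (x a : R) :
  iter n (@decim R) x = 3 -> a != 0 -> (descend n x (a, - 3 * a)).1 != 0.
Proof.
move=> x3 a0.
have inv k p y : iter k (@decim R) x = y -> y * p.1 = p.2 * (2 - y) -> p.2 != 0 ->
    x * (descend k x p).1 = (descend k x p).2 * (2 - x) /\ (descend k x p).2 != 0.
  elim: k p y => [|k IHk] p y /=; first by move=> ->.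
  set z := iter k _ x => <- rel e0.
  have e4 : (step z p).2 = 4 * p.2 by rewrite /= mulNr rel; ring.
  apply: (IHk _ z erefl); last by rewrite e4 mulf_neq0 // pnatr_eq0.
  rewrite e4 /=.
  transitivity ((4 - z) * (decim z * p.1) + z * (6 - z) * (3 - z) * p.2).
    by rewrite /decim; ring.
  by rewrite rel /decim; ring.
have a30 : - 3 * a != 0 by rewrite mulf_neq0 // oppr_eq0 pnatr_eq0.
have [||rel e0] := inv n (a, - 3 * a) 3 x3 => //=; first by ring.
apply/eqP => A0; move: rel; rewrite A0 mulr0 => /esym/eqP.
rewrite mulf_eq0 (negPf e0) subr_eq0 /= => /eqP x2.
(* The orbit of 2 is 2, 6, -6 and then stays negative, so it never meets 3. *)
move: x3; rewrite -x2; case: n {inv A0 e0} => [|[|n]].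
- by rewrite /=; lra.
- by rewrite /= /decim; lra.
rewrite !iterSr (_ : decim (decim 2) = - 6); last by rewrite /decim; ring.
by have := @iter_decim_neg R n (- 6) ltac:(lra); lra.
Qed.

Definition evalz (R : realFieldType) (P : {poly int}) (x : R) : R :=
  (map_poly intr P).[x].

Lemma evalzE (R : realFieldType) (x : R) :
  (forall P Q : {poly int}, evalz (P + Q) x = evalz P x + evalz Q x) *
  (forall P Q : {poly int}, evalz (P * Q) x = evalz P x * evalz Q x) *
  (forall P : {poly int}, evalz (- P) x = - evalz P x) *
  (forall P k, evalz (P ^+ k) x = evalz P x ^+ k) *
  (forall c : int, evalz c%:P x = c%:~R) * (evalz 'X x = x).
Proof.
rewrite /evalz; do ![split] => [P Q|P Q|P|P k|c|].
- by rewrite rmorphD hornerD.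
- by rewrite rmorphM hornerM.
- by rewrite rmorphN hornerN.
- by rewrite rmorphXn horner_exp.
- by rewrite map_polyC hornerC.
- by rewrite map_polyX hornerX.
Qed.

Lemma evalz_comp_decim (R : realFieldType) (P : {poly int}) (x : R) :
  evalz (P \Po ('X * (5%:P - 'X))) x = evalz P (decim x).
Proof.
rewrite {1}/evalz map_comp_poly horner_comp -/(evalz _ _) -/(evalz _ _).
by rewrite !evalzE.
Qed.

(* Norm from [Z[x]] down to [Z[decim x]]: the conjugate of [x] is [5 - x]. *)
Lemma evalz_neq0 (R : realFieldType) (n : nat) (x : R) (P : {poly int}) :
  iter n (@decim R) x = 5 -> ~~ (5 %| P`_0)%Z -> evalz P x != 0.
Proof.
elim: n x P => [|n IHn] x P.
  move=> /= -> nP; apply: contra nP; rewrite /evalz.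
  have -> : (5 : R) = intr 5 by [].
  rewrite horner_map intr_eq0 => /eqP P5.
  elim/poly_ind: P P5 => [|Q c _]; first by rewrite coef0.
  rewrite hornerMXaddC coefD coefMX coefC /= add0r => /eqP.
  by rewrite addr_eq0 -eqr_oppLR => /eqP <-; rewrite rpredN dvdz_mull.
rewrite iterSr => x5 nP.
(* Reduction by $y^2=5y-$[decim y]: every integer polynomial in [y] becomes linear over the integer
   polynomials in [decim y]. *)
have [p [q [Ppq P0]]] : exists p q : {poly int},
    (forall y : R, evalz P y = evalz p (decim y) + y * evalz q (decim y)) /\ p`_0 = P`_0.
  elim/poly_ind: {nP} P => [|P c [p [q [Ppq _]]]].
    by exists 0, 0; split=> // y; rewrite /evalz rmorph0 !horner0 mulr0 addr0.
  exists (c%:P - 'X * q), (p + 5%:P * q); split.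
    by move=> y; rewrite !evalzE Ppq /decim; ring.
  by rewrite coefB coefC coefXM !coefD coefMX coefC /= subr0 add0r.
(* The product of $p+xq$ and its conjugate $p+(5-x)q$; modulo 5 its constant coefficient is the
   square of that of [P]. *)
pose N := p ^+ 2 + 5%:P * p * q + 'X * q ^+ 2.
have NE : evalz N (decim x) = evalz P x * evalz P (5 - x).
  rewrite !Ppq (_ : decim (5 - x) = decim x); last by rewrite /decim; ring.
  by rewrite /N !evalzE /decim; ring.
have := IHn (decim x) N x5 _; rewrite NE mulf_eq0 negb_or => H.
suff /H/andP[] : ~~ (5 %| N`_0)%Z by [].
rewrite /N !coefD coefXM /= addr0 -!horner_coef0 !hornerE !horner_coef0 P0.
rewrite -mulrA rpredDr; last by rewrite dvdz_mulr.
by rewrite dvdzE expr2 abszM Euclid_dvdM // orbb -dvdzE.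
Qed.

(** Up to the factor [a], the pair consists of two integer polynomials evaluated at [x]. A step
    sends their constant coefficients $(a,b)$ to $(20a+18b,6b)$, which is $(3b,b)$ modulo 5; from
    $(-1,3)$ on, both stay prime to 5. *)
Lemma descend5_neq0 (R : realFieldType) (n : nat) (x a : R) :
  iter n (@decim R) x = 5 -> a != 0 -> (descend n x (- a, 3 * a)).1 != 0.
Proof.
move=> x5 a0.
have [P [Q [PE QE nP _]]] : exists P Q : {poly int},
   [/\ (descend n x (-1, 3)).1 = evalz P x, (descend n x (-1, 3)).2 = evalz Q x,
     ~~ (5 %| P`_0)%Z & ~~ (5 %| Q`_0)%Z].
  elim: n {x5 a0} x => [|n IHn] x.
    exists (-1)%:P, 3%:P; split; rewrite ?coefC //= !evalzE //.
  have [P [Q [PE QE nP nQ]]] := IHn (decim x).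
  pose d : {poly int} := 'X * (5%:P - 'X).
  exists ((4%:P - 'X) * (5%:P - 'X) * (P \Po d) + (6%:P - 'X) * (3%:P - 'X) * (Q \Po d)).
  exists (- d * (P \Po d) + (6%:P - d) * (Q \Po d)).
  have cd (S : {poly int}) : (S \Po d)`_0 = S`_0.
    by rewrite -!horner_coef0 horner_comp !hornerE.
  split.
  - by rewrite descendS /= PE QE !evalzE !evalz_comp_decim; ring.
  - by rewrite descendS /= PE QE !evalzE !evalz_comp_decim /decim; ring.
  - rewrite -horner_coef0 !hornerE !horner_coef0 !cd.
    by move: nQ; move: (P`_0) (Q`_0) => a' b'; lia.
  - rewrite -horner_coef0 !hornerE !horner_coef0 !cd.
    by move: nQ; move: (P`_0) (Q`_0) => a' b'; lia.
have := descendZ n x a (-1, 3); rewrite /= mulrN1 mulrC => ->.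
by rewrite mulf_neq0 // PE (evalz_neq0 x5).
Qed.

(** * Eigenfunctions on a cell *)

Lemma sum_ord3 (V : nmodType) (f : 'I_3 -> V) :
  \sum_i f i = f 0 + f 1 + f 2%:R.
Proof.
rewrite !big_ord_recl big_ord0 addr0 addrA.
by congr (f _ + f _ + f _); apply/val_inj.
Qed.

Lemma ord3P (P : 'I_3 -> Prop) : P 0 -> P 1 -> P 2%:R -> forall i, P i.
Proof.
move=> P0 P1 P2 [[|[|[|k]]] Hk] //.
- by rewrite (_ : Ordinal Hk = 0) //; apply/val_inj.
- by rewrite (_ : Ordinal Hk = 1) //; apply/val_inj.
- by rewrite (_ : Ordinal Hk = 2%:R) //; apply/val_inj.
Qed.

(** Negation in $\mathbb Z/3$ fixes 0 and exchanges 1 and 2; applied to letters and corners it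
    encodes the reflections. *)
Lemma ord3N : (- 0 = 0 :> 'I_3) * (- 1 = 2%:R :> 'I_3) * (- 2%:R = 1 :> 'I_3).
Proof. by do ![split]; apply/val_inj. Qed.

(** As $0+1+2=0$ in $\mathbb Z/3$, this is the remaining corner when [i] and [j] differ. *)
Definition third (i j : 'I_3) : 'I_3 := - (i + j).

Lemma thirdE : (third 0 1 = 2%:R) * (third 0 2%:R = 1) * (third 1 2%:R = 0).
Proof. by do ![split]; apply/val_inj. Qed.

Lemma thirdC i j : third i j = third j i.
Proof. by rewrite /third addrC. Qed.

Lemma sum_third (R : comPzRingType) (y : 'I_3 -> R) i j : i != j ->
  y i + y j + y (third i j) = \sum_k y k.
Proof.
rewrite sum_ord3; elim/ord3P: i; elim/ord3P: j => // _.
- by rewrite thirdE; ring.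
- by rewrite thirdE; ring.
- by rewrite thirdC thirdE; ring.
- by rewrite thirdE; ring.
- by rewrite thirdC thirdE; ring.
- by rewrite thirdC thirdE; ring.
Qed.

Lemma sum_if_third (R : comPzRingType) (y : 'I_3 -> R) (a : R) i :
  \sum_j (if j == i then a else y (third i j)) = a + \sum_j y j - y i.
Proof.
rewrite !sum_ord3; elim/ord3P: i => /=.
- by rewrite !thirdE; ring.
- by rewrite [third 1 0]thirdC !thirdE; ring.
- by rewrite [third _ 0]thirdC [third _ 1]thirdC !thirdE; ring.
Qed.

(* [U w i] is the value at the point [F_w q_i] of a function on a cell, where
   all the words [w] have the same length. *)
Definition cellfun (R : Type) := seq 'I_3 -> 'I_3 -> R.

Definition subcell (R : Type) (i : 'I_3) (U : cellfun R) : cellfun R :=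
  fun w => U (i :: w).

Definition bval (R : Type) (n : nat) (U : cellfun R) (i : 'I_3) : R :=
  U (nseq n i) i.

(* Half of the diagonal term of [Delta + lam] goes to each of the two cells
   that meet at a vertex. *)
Definition flux (R : realFieldType) (lam : R) (c : 'I_3 -> R) (i : 'I_3) : R :=
  (3 - lam / 2) * c i - \sum_j c j.

Definition bflux (R : realFieldType) (lam : R) (n : nat) (U : cellfun R)
  (i : 'I_3) : R := flux lam (U (nseq n i)) i.

(** The eigenvalue equation at the inner vertices of a cell; its three corners carry no
    condition. *)
Fixpoint sol (R : realFieldType) (lam : R) (n : nat) (U : cellfun R) : Prop :=
  if n is k.+1 then
    (forall i, sol lam k (subcell i U)) /\
    (forall i j : 'I_3, i != j ->
       bval k (subcell i U) j = bval k (subcell j U) i /\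
       bflux lam k (subcell i U) j + bflux lam k (subcell j U) i = 0)
  else True.

Section Cell.

Variables (R : realFieldType) (lam : R).

Local Notation x n := (iter n (@decim R) lam).

(** When [kappa n] is nonzero, the Dirichlet-to-Neumann matrix of a nondegenerate cell is
    $\sigma_nI-\kappa_n^{-1}J$ with $J$ the all-ones matrix; [sigma n] is its eigenvalue on vectors
    of sum zero. *)
Fixpoint sigma (n : nat) : R :=
  if n is k.+1 then sigma k * (3 - x k) / (5 - x k) else 3 - lam / 2.

Definition kappa (n : nat) : R :=
  if n is k.+1 then (2 - x k) * (5 - x k) / (2 * sigma k) else 1.

(* The value [x k = 2], although forbidden for spectral decimation, is harmless
   here: there [kappa k.+1 = 0] and the flux is not determined by the values. *)
Definition nondeg (n : nat) := forall k, (k < n)%N -> sigma k != 0 /\ x k != 5.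

Lemma nondegW m n : (m <= n)%N -> nondeg n -> nondeg m.
Proof. by move=> mn gn k km; apply: gn; apply: leq_trans km mn. Qed.

Lemma sigma_kappa n : nondeg n -> sigma n * kappa n = (6 - x n) / 2.
Proof.
case: n => [_|n gn]; first by rewrite /kappa /= mulr1; field.
have [s0 x5] := gn n (ltnSn n).
rewrite /kappa iterS /=; move: x5 s0; set z := x n; set s := sigma n => x5 s0.
by rewrite /decim; field; rewrite s0 subr_eq0 eq_sym.
Qed.

(* Dirichlet-to-Neumann relation of a cell; [tau] stays free when [kappa]
   vanishes. *)
Definition cellrel (n : nat) (v phi : 'I_3 -> R) (tau : R) :=
  (forall i, phi i = sigma n * v i + tau) /\ kappa n * tau + \sum_i v i = 0.

Lemma cellrel0 (U : cellfun R) :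
  cellrel 0 (bval 0 U) (bflux lam 0 U) (- \sum_i U [::] i).
Proof. by split=> [i|]; rewrite ?mul1r ?addNr. Qed.

(* The three subcells of a cell: [y0] is the value at the vertex opposite to
   the corner [0], and so on. *)
Lemma glue_rel n (a0 a1 a2 y0 y1 y2 t0 t1 t2 : R) :
  nondeg n.+1 ->
  kappa n * t0 + (a0 + y1 + y2) = 0 ->
  kappa n * t1 + (a1 + y0 + y2) = 0 ->
  kappa n * t2 + (a2 + y0 + y1) = 0 ->
  2 * sigma n * y0 + t1 + t2 = 0 ->
  2 * sigma n * y1 + t0 + t2 = 0 ->
  2 * sigma n * y2 + t0 + t1 = 0 ->
  exists2 tau, kappa n.+1 * tau + (a0 + a1 + a2) = 0 &
    [/\ sigma n * a0 + t0 = sigma n.+1 * a0 + tau,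
        sigma n * a1 + t1 = sigma n.+1 * a1 + tau
      & sigma n * a2 + t2 = sigma n.+1 * a2 + tau].
Proof.
move=> gn e0 e1 e2 f0 f1 f2.
have sk := sigma_kappa (nondegW (leqnSn n) gn).
have [s0 x5] := gn n (ltnSn n).
have x50 : 5 - x n != 0 by rewrite subr_eq0 eq_sym.
move: sk e0 e1 e2; rewrite /=; set s := sigma n; set k := kappa n; set z := x n.
rewrite -/s -/z in s0 x5 x50 f0 f1 f2 *.
move=> sk e0 e1 e2.
(* The system is invariant under permutations of the corners: it splits into the total, with the
   factor [2 - z], and the differences, with the factor [5 - z]. *)
have T : t0 + t1 + t2 = - s * (y0 + y1 + y2) by nra.
have A : a0 + a1 + a2 = (2 - z) / 2 * (y0 + y1 + y2).
  have : k * (t0 + t1 + t2) = - (s * k) * (y0 + y1 + y2) by rewrite T; ring.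
  by rewrite sk; lra.
have D (a b y y' t t' c : R) : k * t + (a + y' + c) = 0 -> k * t' + (b + y + c) = 0 ->
    t - t' = 2 * s * (y - y') -> (5 - z) * (y - y') = b - a.
  move=> h1 h2 h3; have : k * (t - t') = 2 * (s * k) * (y - y') by rewrite h3; ring.
  by rewrite sk; lra.
have d01 := D a0 a1 y0 y1 t0 t1 y2 ltac:(lra) ltac:(lra) ltac:(lra).
have d02 := D a0 a2 y0 y2 t0 t2 y1 ltac:(lra) ltac:(lra) ltac:(lra).
have H a y t : 2 * a + 2 * (5 - z) * y = (4 - z) * (y0 + y1 + y2) ->
    t = - s * (y0 + y1 + y2) + 2 * s * y ->
    s * a + t = s * (3 - z) / (5 - z) * a + - s * (y0 + y1 + y2) / (5 - z).
  move=> h ->; rewrite [X in _ = X + _]mulrAC -[RHS]mulrDl.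
  apply: (mulIf x50); rewrite divfK //.
  apply/eqP; rewrite -subr_eq0.
  set Y := y0 + y1 + y2 in h *.
  have -> : (s * a + (- s * Y + 2 * s * y)) * (5 - z) - (s * (3 - z) * a + - s * Y)
      = s * (2 * a + 2 * (5 - z) * y - (4 - z) * Y) by ring.
  by rewrite h subrr mulr0.
exists (- s * (y0 + y1 + y2) / (5 - z)).
  by rewrite A; field; rewrite s0 x50.
by split; [apply: (H _ y0)|apply: (H _ y1)|apply: (H _ y2)]; lra.
Qed.

Lemma sol_rel n (U : cellfun R) : nondeg n -> sol lam n U ->
  exists tau, cellrel n (bval n U) (bflux lam n U) tau.
Proof.
elim: n U => [U _ _|n IHn U gn [solU glue]]; first by eexists; exact: cellrel0.
have gn' := nondegW (leqnSn n) gn.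
have [t0 [p0 r0]] := IHn _ gn' (solU 0).
have [t1 [p1 r1]] := IHn _ gn' (solU 1).
have [t2 [p2 r2]] := IHn _ gn' (solU 2%:R).
have [v01 f01] := glue 0 1 isT.
have [v02 f02] := glue 0 2%:R isT.
have [v12 f12] := glue 1 2%:R isT.
move: r0 r1 r2 f01 f02 f12; rewrite !sum_ord3 !p0 !p1 !p2 v01 v02 v12.
move=> r0 r1 r2 f01 f02 f12.
have [||||||tau rtau [q0 q1 q2]] := @glue_rel n
   (bval n (subcell 0 U) 0) (bval n (subcell 1 U) 1)
   (bval n (subcell 2%:R U) 2%:R) (bval n (subcell 2%:R U) 1) (bval n (subcell 2%:R U) 0)
   (bval n (subcell 1 U) 0) t0 t1 t2 gn; try lra.
exists tau; split; last by rewrite sum_ord3.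
apply: ord3P; [exact: (etrans (p0 _) q0)|exact: (etrans (p1 _) q1)|].
exact: (etrans (p2 _) q2).
Qed.

(** Zero value and flux at an outer corner give [tau = 0] in the subcell there. Flux balance at a
    junction then reads [2 * sigma n] times the common value, so the junction values vanish and the
    argument descends. *)
Lemma sol_uniq n (U : cellfun R) : nondeg n -> sol lam n U ->
  (forall i, bval n U i = 0) -> (forall i, bflux lam n U i = 0) ->
  forall w i, size w = n -> U w i = 0.
Proof.
elim: n U => [U _ _ v0 _ w i /size0nil -> //|n IHn U gn [solU glue] v0 f0].
  exact: v0.
have gn' := nondegW (leqnSn n) gn.
have [s0 _] := gn n (ltnSn n).
have /fin_all_exists[t rel] : forall i, exists tau,
    cellrel n (bval n (subcell i U)) (bflux lam n (subcell i U)) tau.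
  by move=> i; exact: sol_rel gn' (solU i).
have t0 i : t i = 0.
  have [/(_ i) h _] := rel i.
  have hv : bval n (subcell i U) i = 0 := v0 i.
  have hf : bflux lam n (subcell i U) i = 0 := f0 i.
  by move: h; rewrite hv hf mulr0 add0r.
have sub0 i j : bval n (subcell i U) j = 0.
  have [->|ij] := eqVneq i j; first exact: v0.
  have [vij fij] := glue i j ij; have [/(_ j) hi _] := rel i; have [/(_ i) hj _] := rel j.
  move: fij; rewrite hi hj !t0 !addr0 -vij -mulr2n => /eqP.
  by rewrite mulrn_eq0 /= mulf_eq0 (negPf s0) /= => /eqP.
case=> [//|i w] j [sw]; apply: (IHn (subcell i U) gn' (solU i) (sub0 i)) => // k.
by have [/(_ k) -> _] := rel i; rewrite sub0 t0 mulr0 addr0.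
Qed.

Lemma sol_exists n (v : 'I_3 -> R) (tau : R) : nondeg n ->
  kappa n * tau + \sum_i v i = 0 ->
  exists U, [/\ sol lam n U, forall i, bval n U i = v i
    & forall i, bflux lam n U i = sigma n * v i + tau].
Proof.
elim: n v tau => [|n IHn] v tau gn rel.
  exists (fun=> v); split=> // i.
  by move: rel; rewrite /bflux /flux /= mul1r; lra.
have gn' := nondegW (leqnSn n) gn.
have [s0 x5] := gn n (ltnSn n).
have sk := sigma_kappa gn'.
have x50 : 5 - x n != 0 by rewrite subr_eq0 eq_sym.
move: sk s0 x50 rel; rewrite /kappa -/(kappa n) /=.
set s := sigma n; set k := kappa n; set z := x n => sk s0 x50 rel.
(* The sum of the three junction values, read off [tau] because [kappa n.+1] may vanish. The
   deviations of [y] from [Y / 3] come from those of [v], divided by [5 - z]. *)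
pose Y := - tau * (5 - z) / s.
pose y i := Y / 3 + ((\sum_i v i) / 3 - v i) / (5 - z).
pose u (i j : 'I_3) := if j == i then v i else y (third i j).
pose t i := - s * (Y - 2 * y i).
have tauE : tau = - s * Y / (5 - z) by rewrite /Y; field; rewrite s0 x50.
have A : \sum_i v i = (2 - z) / 2 * Y.
  have -> : \sum_i v i = - ((2 - z) * (5 - z) / (2 * s) * tau).
    by apply/eqP; rewrite -subr_eq0 opprK addrC rel.
  by rewrite tauE; field; rewrite s0 x50.
have yE i : (5 - z) * y i + v i = (4 - z) / 2 * Y.
  rewrite /y A; field; by rewrite x50.
have sumy : \sum_i y i = Y.
  by rewrite /y !sum_ord3; field; rewrite x50.
have sumu i : \sum_j u i j = v i + Y - y i by rewrite /u sum_if_third sumy.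
have /fin_all_exists[W HW] : forall i, exists U, [/\ sol lam n U,
     forall j, bval n U j = u i j & forall j, bflux lam n U j = s * u i j + t i].
  move=> i; apply: IHn => //; rewrite sumu -/k /t.
  transitivity (- (s * k) * (Y - 2 * y i) + (v i + Y - y i)); first by ring.
  rewrite sk; have := yE i; move: (y i) (v i) => a b; clear; lra.
pose U w := if w is i :: w' then W i w' else fun=> 0.
exists U; split.
- split=> [i|i j ij]; first by have [] := HW i.
  have [_ vi fi] := HW i; have [_ vj fj] := HW j.
  have uij : u i j = y (third i j) by rewrite /u eq_sym (negPf ij).
  have uji : u j i = y (third i j) by rewrite /u (negPf ij) thirdC.
  split; first by rewrite vi vj uij uji.
  rewrite fi fj uij uji.
  have := sum_third y ij; rewrite sumy.
  by rewrite /t => <-; ring.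
- by move=> i; have [_ vi _] := HW i; rewrite [LHS]vi /u eqxx.
move=> i; have [_ _ fi] := HW i; rewrite [LHS]fi /u eqxx /t tauE.
rewrite [X in _ = X + _]mulrAC -[RHS]mulrDl.
apply: (mulIf x50); rewrite divfK //; apply/eqP; rewrite -subr_eq0.
have -> : (s * v i + - s * (Y - 2 * y i)) * (5 - z) - (s * (3 - z) * v i + - s * Y)
   = 2 * s * ((5 - z) * y i + v i - (4 - z) / 2 * Y) by field.
by rewrite yE subrr mulr0.
Qed.

Lemma flux_comb (a b : R) (c d : 'I_3 -> R) i :
  flux lam (fun j => a * c j + b * d j) i = a * flux lam c i + b * flux lam d i.
Proof. by rewrite /flux big_split /= -!mulr_sumr; ring. Qed.

Lemma sol_comb n (a b : R) (U W : cellfun R) : sol lam n U -> sol lam n W ->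
  sol lam n (fun w i => a * U w i + b * W w i).
Proof.
elim: n U W => [//|n IHn] U W [sU gU] [sW gW].
split=> [i|i j ij]; first exact: IHn (sU i) (sW i).
have [vU fU] := gU i j ij; have [vW fW] := gW i j ij.
move: vU vW fU fW; rewrite /bval /bflux /subcell => -> -> fU fW; split=> //.
by rewrite !flux_comb addrACA -!mulrDr fU fW !mulr0 addr0.
Qed.

Definition mirror (U : cellfun R) : cellfun R := fun w i => U (map -%R w) (- i).

Lemma flux_mirror (c : 'I_3 -> R) i : flux lam (fun j => c (- j)) i = flux lam c (- i).
Proof.
by rewrite /flux !sum_ord3 !ord3N [c 0 + _ + _]addrAC.
Qed.

Lemma bval_mirror n (U : cellfun R) i : bval n (mirror U) i = bval n U (- i).
Proof. by rewrite /bval /mirror map_nseq. Qed.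

Lemma bflux_mirror n (U : cellfun R) i :
  bflux lam n (mirror U) i = bflux lam n U (- i).
Proof. by rewrite /bflux /mirror map_nseq -flux_mirror. Qed.

Lemma sol_mirror n (U : cellfun R) : sol lam n U -> sol lam n (mirror U).
Proof.
elim: n U => [//|n IHn] U [sU gU].
split=> [i|i j ij]; first exact: (IHn (subcell (- i) U) (sU (- i))).
have nij : - i != - j by rewrite (inj_eq oppr_inj).
have [vU fU] := gU _ _ nij.
split.
  by rewrite (bval_mirror n (subcell (- i) U)) (bval_mirror n (subcell (- j) U)).
by rewrite (bflux_mirror n (subcell (- i) U)) (bflux_mirror n (subcell (- j) U)).
Qed.

(** With [sigma n = 0] a subcell has one flux [t i] at all its corners, and $t_i+t_j=0$ for the
    three pairs forces [t = 0]. *)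
Lemma sol_flux0 n (U : cellfun R) : nondeg n -> sigma n = 0 -> sol lam n.+1 U ->
  forall i, bflux lam n.+1 U i = 0.
Proof.
move=> gn s0 [solU glue].
have /fin_all_exists[t rel] : forall i, exists tau,
    cellrel n (bval n (subcell i U)) (bflux lam n (subcell i U)) tau.
  by move=> i; exact: sol_rel gn (solU i).
have tt i j : i != j -> t i + t j = 0.
  move=> ij; have [_] := glue i j ij.
  have [-> _] := rel i; have [-> _] := rel j.
  by rewrite s0 !mul0r !add0r.
have t01 := tt 0 1 isT; have t02 := tt 0 2%:R isT; have t12 := tt 1 2%:R isT.
have t0 i : t i = 0 by elim/ord3P: i; lra.
by move=> i; have [/(_ i) h _] := rel i; rewrite [LHS]h s0 t0 mul0r addr0.
Qed.

(** At [x n = 5] one has $\sigma_n\kappa_n=1/2$. Flux balance, combined with the relations of two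
    subcells, then says that any two corner values add up to minus the sum of the junction values,
    so the corner values coincide. Larger cells inherit this by gluing. *)
Lemma sol_const n k (U : cellfun R) : nondeg n -> x n = 5 -> (n < k)%N ->
  sol lam k U -> forall i j, bval k U i = bval k U j.
Proof.
move=> gn x5; elim: k U => [//|k IHk] U; rewrite ltnS leq_eqVlt.
move=> /orP[/eqP nk|nk] [solU glue].
  rewrite -nk in solU glue *.
  have sk : sigma n * kappa n = 1 / 2 by rewrite sigma_kappa // x5; field.
  have /fin_all_exists[t rel] : forall i, exists tau,
      cellrel n (bval n (subcell i U)) (bflux lam n (subcell i U)) tau.
    by move=> i; exact: sol_rel gn (solU i).
  have g i j : i != j -> bval n (subcell i U) j = bval n (subcell j U) i /\
      bval n (subcell i U) j + kappa n * (t i + t j) = 0.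
    move=> ij; have [v f] := glue i j ij; split=> //.
    move: f; have [-> _] := rel i; have [-> _] := rel j; rewrite -v.
    move/(congr1 ( *%R (kappa n))); rewrite mulr0 => <-.
    transitivity (2 * (sigma n * kappa n) * bval n (subcell i U) j + kappa n * (t i + t j)).
      by rewrite sk; field.
    by ring.
  have [v01 f01] := g 0 1 isT; have [v02 f02] := g 0 2%:R isT.
  have [v12 f12] := g 1 2%:R isT.
  have [_ r0] := rel 0; have [_ r1] := rel 1; have [_ r2] := rel 2%:R.
  move: r0 r1 r2; rewrite !sum_ord3 v01 v02 v12 => r0 r1 r2.
  have a01 : bval n (subcell 0 U) 0 = bval n (subcell 1 U) 1 by lra.
  have a02 : bval n (subcell 0 U) 0 = bval n (subcell 2%:R U) 2%:R by lra.
  have c i : bval n.+1 U i = bval n (subcell 0 U) 0.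
    by elim/ord3P: i; [|rewrite a01|rewrite a02].
  by move=> i j; rewrite !c.
have c i j l : bval k (subcell i U) j = bval k (subcell i U) l by apply: IHk (solU i) _ _.
move=> i j; have [->//|ij] := eqVneq i j.
have [v _] := glue i j ij.
have e1 : bval k.+1 U i = bval k (subcell i U) j := c i i j.
have e2 : bval k.+1 U j = bval k (subcell j U) i := c j j i.
by rewrite e1 e2.
Qed.

End Cell.

(** * Eigenfunctions between a vertex and the bottom line *)

(* [U] lives on a cell [F_w SG] of level [k], [w] in the symbols 1 and 2; the
   eigenvalue equation is imposed everywhere except at [F_w q_0]. *)
Fixpoint dom (R : realFieldType) (lam : R) (k : nat) (U : cellfun R) : Prop :=
  if k is k'.+1 then
    [/\ sol lam k' (subcell 0 U),
        forall i, i != 0 -> dom lam k' (subcell i U),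
        forall i, i != 0 -> bval k' (subcell 0 U) i = bval k' (subcell i U) 0
      & (0 < k')%N -> forall i, i != 0 ->
          bflux lam k' (subcell 0 U) i + bflux lam k' (subcell i U) 0 = 0]
  else forall i, U [::] i = 0.

(** Invariance under [R_w] for the words in 1 and 2, the empty one included. A primitive solution
    may be odd on the whole triangle, so [primsol] asks this of the subcells 1 and 2. *)
Fixpoint allsym (R : realFieldType) (k : nat) (U : cellfun R) : Prop :=
  (forall w i, size w = k -> mirror U w i = U w i) /\
  if k is k'.+1 then forall i, i != 0 -> allsym k' (subcell i U) else True.

(** The value at $F_wq_0$ for $w=1^{k-1}$, on the row next to the bottom; the final letter 0 brings
    the word to length [k]. By symmetry the whole row has this value, the free parameter of the
    upward shooting. *)
Definition bot (R : realFieldType) (k : nat) (U : cellfun R) : R :=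
  U (rcons (nseq k.-1 1) 0) 0.

Lemma word12_opp w : word12 (map -%R w) = word12 w.
Proof. by rewrite /word12 all_map; apply: eq_all => i /=; rewrite oppr_eq0. Qed.

Section Domain.

Variables (R : realFieldType) (lam : R).

Local Notation x n := (iter n (@decim R) lam).
Local Notation sigma := (sigma lam).
Local Notation kappa := (kappa lam).

(* Value at [F_w q_0] and flux there from the cell below, for the solution that
   vanishes on the bottom row and is [1] on the row next to it. *)
Fixpoint shoot (n : nat) : R * R :=
  if n is k.+1 then
    let: (b, p) := shoot k in
    (kappa k * p + (2 - x k) / 2 * b, (4 - x k) / 2 * p - sigma k * x k / 2 * b)
  else (0, 1).

Lemma shootS n : shoot n.+1 =
  (kappa n * (shoot n).2 + (2 - x n) / 2 * (shoot n).1,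
   (4 - x n) / 2 * (shoot n).2 - sigma n * x n / 2 * (shoot n).1).
Proof. by rewrite /=; case: (shoot n). Qed.

(* Conservation of the Wronskian of the solutions shot from [q_0] and from the
   bottom row. *)
Lemma descend_shoot n (p : R * R) : nondeg lam n ->
  (descend n lam p).1 = \prod_(k < n) (2 * (5 - x k)) *
    (sigma n * p.2 * (shoot n).1 + p.1 * (shoot n).2).
Proof.
elim: n p => [|n IHn] p gn; first by rewrite big_ord0 /= mulr0 add0r mulr1 mul1r.
have gn' := nondegW (leqnSn n) gn.
have [s0 x5] := gn n (ltnSn n).
have x50 : 5 - x n != 0 by rewrite subr_eq0 eq_sym.
rewrite /= IHn // big_ord_recr -[RHS]mulrA /=; congr (_ * _).
have := sigma_kappa gn'; case: (shoot n) => b psi /=.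
move: (x n) (sigma n) (kappa n) s0 x50 => z s k s0 x50 sk; rewrite /decim.
have -> : s * (3 - z) / (5 - z) * p.2 * (k * psi + (2 - z) / 2 * b) =
   ((3 - z) * p.2 * ((s * k) * psi + (2 - z) / 2 * (s * b))) / (5 - z) by field.
by rewrite sk; field.
Qed.

Lemma prod_decim_neq0 n : nondeg lam n -> \prod_(k < n) (2 * (5 - x k)) != 0.
Proof.
move=> gn; apply/prodf_neq0 => k _; rewrite mulf_neq0 ?pnatr_eq0 //.
by rewrite subr_eq0 eq_sym; have [] := gn k (ltn_ord k).
Qed.

Lemma allsym_bot k (U : cellfun R) w : allsym k U -> size w = k.-1 -> word12 w ->
  U (rcons w 0) 0 = bot k U.
Proof.
elim: k U w => [|k IHk] U w [mU sU]; first by move=> /size0nil ->.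
case: k IHk sU mU => [|k] IHk sU mU; first by move=> /size0nil ->.
case: w => [//|a w] /= [sw] /andP[a0 w12].
have H v : size v = k -> word12 v -> U (1 :: rcons v 0) 0 = bot k.+2 U.
  by move=> sv v12; have := IHk _ v (sU 1 isT) sv v12.
move: a0; elim/ord3P: a => // _; first exact: H.
have <- := mU (2%:R :: rcons w 0) 0; last by rewrite /= size_rcons sw.
by rewrite /mirror /= map_rcons !oppr0 ord3N H ?size_map ?word12_opp.
Qed.

Lemma sol_uniq_bottom n (U : cellfun R) : nondeg lam n -> sol lam n U ->
  (forall i, i != 0 -> bval n U i = 0) ->
  (forall i, i != 0 -> bflux lam n U i = 0) ->
  forall w i, size w = n -> U w i = 0.
Proof.
move=> gn solU v0 f0; have [tau [p r]] := sol_rel gn solU.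
have t0 : tau = 0 by have := p 1; rewrite v0 // f0 // mulr0 add0r.
move: r; rewrite t0 mulr0 add0r sum_ord3 (v0 1) // (v0 2%:R) // !addr0 => b0.
apply: sol_uniq gn solU _ _ => i; have [->//|i0] := eqVneq i 0.
- exact: v0.
- by rewrite p b0 t0 mulr0 addr0.
- exact: f0.
Qed.

(** By symmetry both lower subcells hand the same value and flux to the top one. A lower corner
    yields [tau], the relation on the sum yields the top value, and [sigma_kappa] produces the
    recursion of [shoot]. *)
Lemma dom_shoot k (U : cellfun R) : nondeg lam k ->
  dom lam k.+1 U -> allsym k.+1 U ->
  bval k.+1 U 0 = bot k.+1 U * (shoot k.+1).1 /\
  bflux lam k.+1 U 0 = bot k.+1 U * (shoot k.+1).2.
Proof.
elim: k U => [|k IHk] U gk domU symU.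
  have [_ d v _] := domU.
  have U0 i : i != 0 -> U [:: 0] i = 0.
    by move=> i0; have := v i i0; rewrite /bval /subcell /= => ->; exact: d.
  rewrite /bval /bflux /flux /bot /= sum_ord3 (U0 1) // (U0 2%:R) //; split; first by field.
  by field.
have [solU d v f] := domU.
have symi i : i != 0 -> allsym k.+1 (subcell i U) by case: symU => _; exact.
have boti i : i != 0 -> bot k.+1 (subcell i U) = bot k.+2 U.
  move=> i0; rewrite -(allsym_bot (w := i :: nseq k 1) symU) //= ?size_nseq //.
  by rewrite /word12 /= i0 all_nseq /= orbT.
have top i : i != 0 -> bval k.+1 (subcell 0 U) i = bot k.+2 U * (shoot k.+1).1 /\
    bflux lam k.+1 (subcell 0 U) i = - (bot k.+2 U * (shoot k.+1).2).
  move=> i0; have [vi fi] := IHk _ (nondegW (leqnSn k) gk) (d i i0) (symi i i0).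
  rewrite -(boti i i0) -vi -fi; split; first exact: v.
  by apply/eqP; rewrite -subr_eq0 opprK f.
have [v1 f1] := top 1 isT; have [v2 _] := top 2%:R isT.
have [tau [p r]] := sol_rel gk solU.
have sk := sigma_kappa gk.
move: r; rewrite sum_ord3 v1 v2 => r.
have := p 1; rewrite v1 f1 => tE.
have p0 := p 0.
rewrite shootS -[bval _ U 0]/(bval k.+1 (subcell 0 U) 0).
rewrite -[bflux _ _ U 0]/(bflux lam k.+1 (subcell 0 U) 0).
rewrite p0 {p0 p f1 v1 v2 top boti f v d}.
move: (bval _ _ 0) r tE sk; move: (shoot _).1 (shoot _).2 (bot _ _) => b psi c.
move: (x k.+1) (kappa _) (sigma _) => z kp s a r tE sk.
have {}tE : tau = - (c * psi) - s * (c * b) by rewrite tE; ring.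
have aE : a = c * (kp * psi + (2 - z) / 2 * b).
  have -> : a = - (kp * tau) - (c * b + c * b) by move: r; clear; lra.
  rewrite tE; transitivity (c * (kp * psi + (s * kp - 2) * b)); first by ring.
  by rewrite sk; field.
split=> //=; rewrite aE tE.
transitivity (c * ((s * kp - 1) * psi + s * (- z / 2) * b)); first by field.
by rewrite sk; field.
Qed.

Lemma dom_uniq k (U : cellfun R) : nondeg lam k.-1 -> dom lam k U -> allsym k U ->
  bot k U = 0 -> forall w i, size w = k -> U w i = 0.
Proof.
elim: k U => [|k IHk] U gk domU symU b0 w i; first by move=> /size0nil ->; exact: domU.
have [solU d v f] := domU.
have symi j : j != 0 -> allsym k (subcell j U) by case: symU => _; exact.
have sub0 j : j != 0 -> forall w i, size w = k -> subcell j U w i = 0.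
  move=> j0; case: k IHk gk domU symU b0 d symi {solU v f} => [|k] IHk gk domU symU b0 d symi.
    by move=> {}w {}i /size0nil ->; exact: d.
  apply: IHk (d j j0) (symi j j0) _; first exact: nondegW (leq_pred _) gk.
  rewrite -b0 -(allsym_bot (w := j :: nseq k 1) symU) //= ?size_nseq //.
  by rewrite /word12 /= j0 all_nseq /= orbT.
case: w => [//|a w] [sw]; have [->|a0] := eqVneq a 0; last exact: sub0 a0 _ _ sw.
have v0 j : j != 0 -> bval k (subcell 0 U) j = 0.
  by move=> j0; rewrite v //; apply: sub0; rewrite ?size_nseq.
case: k {IHk} w sw gk domU symU b0 solU d v f symi sub0 v0 =>
  [|k] w sw gk domU symU b0 solU d v f symi sub0 v0.
  by rewrite (size0nil sw); have [->//|i0] := eqVneq i 0; exact: v0.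
apply: (sol_uniq_bottom gk solU v0) sw => j j0.
have -> : bflux lam k.+1 (subcell 0 U) j = - bflux lam k.+1 (subcell j U) 0.
  by apply/eqP; rewrite -subr_eq0 opprK f.
by rewrite /bflux /flux sum_ord3 !sub0 ?size_nseq //; ring.
Qed.

Lemma flux_opp (c : 'I_3 -> R) i : flux lam (fun j => - c j) i = - flux lam c i.
Proof. by rewrite /flux sumrN; ring. Qed.

Lemma flux_ext (c d : 'I_3 -> R) i : c =1 d -> flux lam c i = flux lam d i.
Proof. by move=> cd; rewrite /flux cd; under eq_bigr do rewrite cd. Qed.

Lemma dom_comb k (a b : R) (U W : cellfun R) : dom lam k U -> dom lam k W ->
  dom lam k (fun w i => a * U w i + b * W w i).
Proof.
elim: k U W => [|k IHk] U W /=.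
  by move=> dU dW i; rewrite dU dW !mulr0 addr0.
move=> [sU dU vU fU] [sW dW vW fW]; split.
- exact: sol_comb.
- by move=> i i0; exact: IHk (dU i i0) (dW i i0).
- by move=> i i0; have := vU i i0; have := vW i i0; rewrite /bval /subcell => -> ->.
- move=> k0 i i0; have := fU k0 i i0; have := fW k0 i i0; rewrite /bflux /subcell => hW hU.
  by rewrite !flux_comb addrACA -!mulrDr hU hW !mulr0 addr0.
Qed.

Lemma allsym_comb k (a b : R) (U W : cellfun R) : allsym k U -> allsym k W ->
  allsym k (fun w i => a * U w i + b * W w i).
Proof.
elim: k U W => [|k IHk] U W [mU sU] [mW sW]; split=> //.
- by move=> w i sw; have := mU w i sw; have := mW w i sw; rewrite /mirror => -> ->.
- by move=> w i sw; have := mU w i sw; have := mW w i sw; rewrite /mirror => -> ->.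
- by move=> i i0; exact: IHk (sU i i0) (sW i i0).
Qed.

Definition glue3 (W0 W1 W2 : cellfun R) : cellfun R := fun w =>
  if w is i :: w' then (if i == 0 then W0 else if i == 1 then W1 else W2) w'
  else fun=> 0.

Lemma sol_mirror_eq n (eps : R) (W : cellfun R) : nondeg lam n -> sol lam n W ->
  (forall i, bval n W (- i) = eps * bval n W i) ->
  (forall i, bflux lam n W (- i) = eps * bflux lam n W i) ->
  forall w i, size w = n -> mirror W w i = eps * W w i.
Proof.
move=> gn solW v f w i sw.
pose D : cellfun R := fun w i => 1 * mirror W w i + (- eps) * W w i.
have solD : sol lam n D by apply: sol_comb => //; exact: sol_mirror.
apply/eqP; rewrite -subr_eq0 -mulNr -{1}[mirror W w i]mul1r; apply/eqP.
apply: (sol_uniq gn solD) sw => j.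
  rewrite -[bval n D j]/(1 * bval n (mirror W) j + - eps * bval n W j).
  by rewrite bval_mirror v; ring.
rewrite /bflux /D flux_comb -!/(bflux lam n _ j) bflux_mirror f; ring.
Qed.

Lemma dom_exists k : nondeg lam k ->
  exists U : cellfun R, [/\ dom lam k.+1 U, allsym k.+1 U & bot k.+1 U = 1].
Proof.
elim: k => [_|k IHk gk].
  exists (fun w i => ((w == [:: 0]) && (i == 0))%:R); split=> //=.
    split=> // i i0.
      by move=> j; rewrite /subcell eqseq_cons (negPf i0).
    by rewrite /bval /subcell /= !eqseq_cons (negPf i0) ?andbF.
  split=> [[|a [|b w]] i //= _|i i0]; rewrite /mirror /=.
    by rewrite !eqseq_cons !oppr_eq0.
  by split=> // w j sw; rewrite /mirror /subcell /= !eqseq_cons (negPf i0).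
have gk' := nondegW (leqnSn k) gk.
have [W [dW sW bW]] := IHk gk'.
have [vW fW] := dom_shoot gk' dW sW; rewrite bW !mul1r in vW fW.
set b := (shoot k.+1).1 in vW; set p := (shoot k.+1).2 in fW.
(* Chosen to balance the flux [p] from below; the top entry of [v] is then dictated by the relation
   on the sum. *)
pose tau := - p - sigma k.+1 * b.
pose v (i : 'I_3) := if i == 0 then - (kappa k.+1 * tau) - b - b else b.
have [|W0 [sW0 v0 f0]] := @sol_exists R lam k.+1 v tau gk.
  by rewrite sum_ord3 /v /=; ring.
have vN i : v (- i) = v i by rewrite /v oppr_eq0.
exists (glue3 W0 W W); split.
- split=> // [i i0|i i0|_ i i0].
  + by rewrite /subcell /= (negPf i0); case: ifP.
  + rewrite /subcell /= (negPf i0) if_same vW; have := v0 i; rewrite /v (negPf i0); exact.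
  + rewrite /subcell /= (negPf i0) if_same fW; have := f0 i; rewrite /v (negPf i0) => ->.
    by rewrite /tau; ring.
- split=> [[//|i w] j [sw]|i i0]; last by rewrite /subcell /= (negPf i0) if_same.
  have [mW _] := sW.
  rewrite /mirror /= oppr_eq0; case: ifP => _; last by rewrite !if_same; exact: mW.
  have := @sol_mirror_eq k.+1 1 W0 gk sW0 _ _ w j sw; rewrite mul1r; apply=> l.
    by rewrite !v0 vN mul1r.
  by rewrite !f0 vN mul1r.
by move: bW; rewrite /bot /=.
Qed.

(** Along the letter 1 one reaches a cell of level [n.+2]. Its top subcell emits no flux by
    [sol_flux0], so the flux at the top of its subcell 1 vanishes. *)
Lemma bot_flux0 n m (U : cellfun R) : nondeg lam n -> sigma n = 0 -> (n.+2 <= m)%N ->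
  dom lam m U -> (forall i, i != 0 -> allsym m.-1 (subcell i U)) ->
  bot m.-1 (subcell 1 U) * (shoot n.+1).2 = 0.
Proof.
move=> gn s0; elim: m U => [//|m IHm] U; rewrite leq_eqVlt => /orP[/eqP[nm]|nm] dU sU.
  rewrite -nm in dU sU *; have [solU d v f] := dU.
  have [_ <-] := dom_shoot gn (d 1 isT) (sU 1 isT).
  by have := f isT 1 isT; rewrite (sol_flux0 gn s0 solU) add0r.
case: m nm IHm dU sU => [//|[//|m]] nm IHm dU sU; have [_ d _ _] := dU.
apply: (IHm (subcell 1 U) nm (d 1 isT)) => i i0.
by have [_] := sU 1 isT; apply.
Qed.

(** By [sol_const] the zero at the top is handed down along the letter 1 to a cell of level [n.+1],
    whose top value [dom_shoot] computes. *)
Lemma bot_const n m (U : cellfun R) : nondeg lam n -> x n = 5 -> (n.+2 <= m)%N ->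
  dom lam m U -> (forall i, i != 0 -> allsym m.-1 (subcell i U)) ->
  bval m U 0 = 0 ->
  bot m.-1 (subcell 1 U) * (shoot n.+1).1 = 0.
Proof.
move=> gn x5; elim: m U => [//|m IHm] U nm dU sU top; have [solU d v f] := dU.
have top1 : bval m (subcell 1 U) 0 = 0.
  by rewrite -(v 1 isT) -top; exact: (sol_const gn x5 nm solU).
move: nm; rewrite leq_eqVlt => /orP[/eqP[nm]|nm].
  rewrite -nm in d sU top1 *.
  by have [<- _] := dom_shoot gn (d 1 isT) (sU 1 isT).
case: m nm IHm dU sU {solU v f top} top1 d => [//|[//|m]] nm IHm dU sU top1 d.
apply: (IHm (subcell 1 U) nm (d 1 isT) _ top1) => i i0.
by have [_] := sU 1 isT; apply.
Qed.

End Domain.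

(** * Primitive solutions on words, where the two shootings meet *)

Definition primsol (R : realFieldType) (lam : R) (sk : bool) (m : nat)
  (U : cellfun R) : Prop :=
  [/\ dom lam m U, forall i, i != 0 -> allsym m.-1 (subcell i U),
      forall w i, size w = m -> mirror U w i = (-1) ^+ sk * U w i
    & bval m U 0 = 0].

(** The downward shooting. The skew pair starts at level 1 and the symmetric one at level 2, hence
    the two iteration counts. *)
Definition top_pair (R : realFieldType) (sk : bool) (m : nat) : R -> R * R :=
  if sk then iter m.-1 (@stepf R) (@skew_init R)
  else iter (m - 2) (@stepf R) (@sym_init R).

Lemma top_pairS (R : realFieldType) sk m : (2 <= m)%N ->
  top_pair sk m.+1 = stepf (@top_pair R sk m).
Proof.
by case: m => [//|[//|m]] _; rewrite /top_pair; case: sk; rewrite ?subSS ?subn0 iterS.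
Qed.

Lemma top_pairD (R : realFieldType) sk m n (lam : R) : (n + 2 <= m)%N ->
  top_pair sk m lam = descend n lam (top_pair sk (m - n) (iter n (@decim R) lam)).
Proof.
move=> nm; rewrite -iter_stepf; congr (_ _); rewrite /top_pair; case: sk; rewrite -iterD.
  by congr iter; lia.
by congr iter; lia.
Qed.

Section PrimitiveWords.

Variables (R : realFieldType) (lam : R).

Local Notation x n := (iter n (@decim R) lam).
Local Notation sigma := (sigma lam).
Local Notation kappa := (kappa lam).
Local Notation shoot := (shoot lam).

Lemma not_nondeg n : ~ nondeg lam n ->
  exists2 k, (k < n)%N & nondeg lam k /\ (sigma k = 0 \/ x k = 5).
Proof.
elim: n => [|n IHn] bad; first by case: bad.
have [gn|/IHn[k kn Hk]] := pselect (nondeg lam n); last by exists k => //; apply: ltnW.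
exists n => //; split=> //.
have [s0|s0] := eqVneq (sigma n) 0; first by left.
have [x5|x5] := eqVneq (x n) 5; first by right.
case: bad => k; rewrite ltnS leq_eqVlt => /orP[/eqP ->|]; [by []|exact: gn].
Qed.

Lemma sigma_eq0 n : nondeg lam n.+1 -> sigma n.+1 = 0 -> x n = 3.
Proof.
move=> gn /eqP; have [s0 x5] := gn n (ltnSn n).
rewrite /= !mulf_eq0 invr_eq0 (negPf s0) !subr_eq0 /= [5 == _]eq_sym (negPf x5) orbF.
by move=> /eqP.
Qed.

Lemma shoot_flux_neq0 n : nondeg lam n -> sigma n = 0 -> (shoot n.+1).2 != 0.
Proof.
case: n => [_ s0|n gn s0].
  have l6 : lam = 6 by move: s0 => /=; lra.
  have -> : (shoot 1).2 = -1 by rewrite /= l6; field.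
  by rewrite oppr_eq0 oner_eq0.
have x3 := sigma_eq0 gn s0.
(* The pair $(1,0)$ isolates the upward flux in the Wronskian, and one step at 3 turns it into
   $(2,-6)$, the case of [descend3_neq0]. *)
have h : (descend n lam (step (x n) (1, 0))).1 =
    \prod_(k < n.+1) (2 * (5 - x k)) * (shoot n.+1).2.
  by rewrite -[LHS]/(descend n.+1 lam (1, 0)).1 descend_shoot // s0 mulr0 mul0r add0r mul1r.
rewrite x3 in h.
have : (descend n lam (step 3 (1, 0))).1 != 0.
  rewrite (_ : step 3 (1, 0) = (2, - 3 * 2)); last first.
    by rewrite /step /decim /=; congr (_, _); ring.
  exact: descend3_neq0.
rewrite h mulf_eq0 negb_or => /andP[_ p0].
rewrite shootS s0 mul0r mul0r mul0r subr0 mulf_neq0 //.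
rewrite iterS x3 /decim; apply: ltr0_neq0; lra.
Qed.

(** For the pair $(-1,3)$ and [x n = 5] the Wronskian is $-2\sigma_n$ times this value, and
    [descend5_neq0] says that it is nonzero. *)
Lemma shoot_val_neq0 n : nondeg lam n -> x n = 5 -> (shoot n.+1).1 != 0.
Proof.
move=> gn x5; have := descend_shoot (-1, 3) gn.
have sk := sigma_kappa gn; rewrite x5 in sk.
have := @descend5_neq0 R n lam 1 x5 (oner_neq0 _).
rewrite mulr1 => /[swap] ->; rewrite mulf_eq0 negb_or => /andP[_].
apply: contra => /eqP; rewrite shootS x5 /= => b0.
apply/eqP; transitivity (- (2 * sigma n) *
   (kappa n * (shoot n).2 + (2 - 5) / 2 * (shoot n).1)); last by rewrite b0 mulr0.
transitivity (- 2 * (sigma n * kappa n) * (shoot n).2 + 3 * (sigma n) * (shoot n).1).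
  by rewrite sk; field.
by field.
Qed.

(** Conservation of the Wronskian. The condition on the right is, in the skew case, flux balance at
    a lower corner of the top subcell, where [tau = 0]; in the symmetric case it is vanishing at
    [q_0]. *)
Lemma top_pair_shoot sk m : (2 <= m)%N -> nondeg lam m.-1 ->
  exists2 c, c != 0 & (top_pair sk m lam).1 = c *
    (if sk then sigma m.-1 * (shoot m.-1).1 + (shoot m.-1).2 else (shoot m).1).
Proof.
case: m => [//|[//|m]] _ gm; case: sk.
  exists (\prod_(k < m.+1) (2 * (5 - x k))); first exact: prod_decim_neq0.
  by rewrite /top_pair iter_stepf descend_shoot // mulr1 mul1r.
have gm' : nondeg lam m := nondegW (leqnSn m) gm.
have [s0 x5] := gm m (ltnSn m).
exists (\prod_(k < m) (2 * (5 - x k)) * (2 * sigma m)).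
  by rewrite mulf_neq0 ?prod_decim_neq0 // mulf_neq0 // pnatr_eq0.
rewrite /top_pair !subSS subn0 iter_stepf descend_shoot // -[RHS]mulrA; congr (_ * _).
have sk := sigma_kappa gm'.
have -> : (shoot m.+2).1 = (2 - x m) * (5 - x m) / (2 * sigma m) * (shoot m.+1).2
    + (2 - decim (x m)) / 2 * (shoot m.+1).1 by rewrite shootS.
rewrite shootS /=; move: s0 sk; move: (shoot m).1 (shoot m).2 (x m) (sigma m) (kappa m).
move=> b p z s k s0 sk; rewrite /decim.
transitivity ((2 - z) * (5 - z) * ((4 - z) / 2 * p - s * z / 2 * b) +
   (2 - z * (5 - z)) * ((s * k) * p + s * ((2 - z) / 2 * b))); last by field.
by rewrite sk; field.
Qed.

(** In the nondegenerate case a nonzero [bot] makes the condition of [top_pair_shoot] hold; at a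
    degenerate parameter [bot_flux0] or [bot_const] forces [bot = 0]. *)
Lemma primsol_bot0 sk m (U : cellfun R) : (2 <= m)%N -> primsol lam sk m U ->
  (top_pair sk m lam).1 != 0 -> bot m.-1 (subcell 1 U) = 0.
Proof.
move=> m2 [dU sU mU top] A0; apply/eqP; apply: contraT => bn0; exfalso.
have [gm|/not_nondeg[n nm [gn bad]]] := pselect (nondeg lam m.-1); last first.
  have nm2 : (n.+2 <= m)%N by lia.
  case: bad => [s0|x5].
    have /eqP := bot_flux0 gn s0 nm2 dU sU.
    by rewrite mulf_eq0 (negPf bn0) (negPf (shoot_flux_neq0 gn s0)).
  have /eqP := bot_const gn x5 nm2 dU sU top.
  by rewrite mulf_eq0 (negPf bn0) (negPf (shoot_val_neq0 gn x5)).
have [c c0 cE] := top_pair_shoot sk m2 gm.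
move: A0; rewrite cE mulf_eq0 negb_or => /andP[_] /eqP; apply.
case: m m2 gm dU sU mU top bn0 {cE c0 c} => [//|[//|m]] _ gm dU sU mU top bn0.
case: sk mU => mU.
  have [solU d v f] := dU.
  have [tau [p r]] := sol_rel gm solU.
  have [v1 f1] := dom_shoot (nondegW (leqnSn m) gm) (d 1 isT) (sU 1 isT).
  have m0 i : bval m.+1 (subcell 0 U) (- i) = - bval m.+1 (subcell 0 U) i.
    have := mU (0 :: nseq m.+1 i) i; rewrite /mirror /= size_nseq mulN1r oppr0.
    by rewrite map_nseq; apply.
  have t0 : tau = 0.
    have e1 := p 1; have e2 := p 2%:R.
    have : bflux lam m.+1 (subcell 0 U) 2%:R = - bflux lam m.+1 (subcell 0 U) 1.
      rewrite -ord3N.1.2 -bflux_mirror /bflux -flux_opp; apply: flux_ext => j.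
      have := mU (0 :: nseq m.+1 1) j; rewrite /mirror /= size_nseq mulN1r oppr0.
      by apply.
    by rewrite e1 e2 -ord3N.1.2 m0; lra.
  have := f isT 1 isT; rewrite p t0 addr0 (v 1 isT) v1 f1 mulrCA -mulrDr => /eqP.
  by rewrite mulf_eq0 (negPf bn0) => /eqP.
have symU : allsym m.+2 U by split=> // w i sw; rewrite mU // expr0 mul1r.
have [v0 _] := dom_shoot gm dU symU.
by move/eqP: v0; rewrite top eq_sym mulf_eq0 (negPf bn0) => /eqP.
Qed.

Lemma primsol_comb sk m (a b : R) (U W : cellfun R) : (0 < m)%N ->
  primsol lam sk m U -> primsol lam sk m W ->
  primsol lam sk m (fun w i => a * U w i + b * W w i).
Proof.
case: m => [//|m] _ [dU sU mU tU] [dW sW mW tW]; split.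
- exact: dom_comb.
- by move=> i i0; exact: (@allsym_comb R m a b _ _ (sU i i0) (sW i i0)).
- move=> w i sw; have := mU w i sw; have := mW w i sw; rewrite /mirror => -> ->.
  by ring.
- by move: tU tW; rewrite /bval => -> ->; rewrite !mulr0 addr0.
Qed.

Lemma primsol_uniq sk m (U : cellfun R) : (2 <= m)%N -> nondeg lam m.-1 ->
  primsol lam sk m U -> bot m.-1 (subcell 1 U) = 0 ->
  forall w i, size w = m -> U w i = 0.
Proof.
case: m => [//|[//|m]] _ gm [dU sU mU top] b0.
have [solU d v f] := dU.
have sub1 w i : size w = m.+1 -> U (1 :: w) i = 0.
  exact: (dom_uniq (k := m.+1) (nondegW (leqnSn m) gm) (d 1 isT) (sU 1 isT) b0).
have sub0 j : j != 0 -> forall w i, size w = m.+1 -> U (j :: w) i = 0.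
  elim/ord3P: j => // _ w i sw.
  have := mU (1 :: map -%R w) (- i); rewrite /mirror /= size_map sw ord3N opprK.
  rewrite mapK; last exact: opprK.
  by move=> -> //; rewrite sub1 ?mulr0 // size_map.
case=> [//|a w] i [sw]; have [->|a0] := eqVneq a 0; last exact: sub0.
apply: (sol_uniq_bottom gm solU _ _) sw => j j0.
  by rewrite v // [LHS]sub0 ?size_nseq.
have -> : bflux lam m.+1 (subcell 0 U) j = - bflux lam m.+1 (subcell j U) 0.
  by apply/eqP; rewrite -subr_eq0 opprK f.
by rewrite /bflux /flux sum_ord3 /subcell !sub0 ?size_nseq //; ring.
Qed.

Lemma primsol_exists sk m : (2 <= m)%N -> nondeg lam m.-1 ->
  (top_pair sk m lam).1 = 0 ->
  exists2 U : cellfun R, primsol lam sk m U & bot m.-1 (subcell 1 U) = 1.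
Proof.
move=> m2 gm A0; have [c c0] := top_pair_shoot sk m2 gm.
rewrite A0 => /esym/eqP; rewrite mulf_eq0 (negPf c0) /= => /eqP.
case: m m2 gm {A0 c0 c} => [//|[//|m]] _ gm; case: sk => /= H0; last first.
  have [U [dU sU bU]] := dom_exists gm; exists U => //; split=> //.
  - by case: sU.
  - by case: sU => mU _ w i sw; rewrite expr0 mul1r mU.
  - by have [-> _] := dom_shoot gm dU sU; rewrite [(shoot _).1]H0 mulr0.
have gm' := nondegW (leqnSn m) gm.
have [W [dW sW bW]] := dom_exists gm'.
have [vW fW] := dom_shoot gm' dW sW; rewrite bW !mul1r in vW fW.
rewrite -/(shoot m.+1) in H0.
pose b := (shoot m.+1).1.
(* An odd top subcell with [tau = 0], above [W] at corner 1 and its negative at corner 2. The root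
   condition [H0] is the flux balance. *)
pose v (i : 'I_3) := if i == 0 then 0 else if i == 1 then b else - b.
have [|W0 [sW0 v0 f0]] := @sol_exists R lam m.+1 v 0 gm.
  by rewrite sum_ord3 /v /= mulr0 !add0r subrr.
have vN i : v (- i) = -1 * v i.
  by elim/ord3P: i; rewrite ord3N /v /= ?mulr0 // mulN1r ?opprK.
pose W2 : cellfun R := fun w i => 0 * W w i + (-1) * W w i.
have dW2 : dom lam m.+1 W2 by exact: dom_comb.
have sW2 : allsym m.+1 W2 by exact: allsym_comb.
have mW : forall w i, size w = m.+1 -> mirror W w i = W w i by case: sW.
have vW2 : bval m.+1 W2 0 = - b by rewrite /bval /W2 -!/(bval _ _ _) vW /b; ring.
have fW2 : bflux lam m.+1 W2 0 = - (shoot m.+1).2.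
  by rewrite /bflux flux_comb -!/(bflux _ _ _ _) fW; ring.
exists (glue3 W0 W W2); last exact: bW.
split.
- split=> // [i i0|i i0|_ i i0].
  + by elim/ord3P: i i0.
  + elim/ord3P: i i0 => // _; first exact: etrans (v0 1) (esym vW).
    exact: etrans (v0 2%:R) (esym vW2).
  + elim/ord3P: i i0 => // _.
      rewrite -[LHS]/(bflux lam m.+1 W0 1 + bflux lam m.+1 W 0) fW f0 /v /=.
      by rewrite addr0.
    rewrite -[LHS]/(bflux lam m.+1 W0 2%:R + bflux lam m.+1 W2 0) fW2 f0 /v /=.
    by rewrite addr0 mulrN -opprD H0 oppr0.
- by move=> i; elim/ord3P: i => // _.
- case=> [//|a w] i [sw]; rewrite /mirror [map _ _]/= expr1; elim/ord3P: a; rewrite ord3N.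
  + have := @sol_mirror_eq R lam m.+1 (-1) W0 gm sW0 _ _ w i sw; apply=> l.
      by rewrite !v0 vN.
    by rewrite !f0 vN; ring.
  + rewrite -[LHS]/(0 * mirror W w i + (-1) * mirror W w i) mW // -[glue3 _ _ _ _ _]/(W w i).
    by ring.
  + rewrite -[LHS]/(mirror W w i) mW // -[glue3 _ _ _ _ _]/(0 * W w i + (-1) * W w i).
    by ring.
- by have := v0 0.
Qed.

(** A degenerate [lam] is 6 or has an iterate 3 or 5. The pair at 3 is a step from the pair at
    [decim 3 = 6], of nonzero value, and has the form $(a,-3a)$; the pair at 5 has the form
    $(-a,3a)$. From neither does [descend] reach the value 0. *)
Lemma root_nondeg sk m : (2 <= m)%N ->
  (forall k, (2 <= k)%N -> (@top_pair R sk k 6).1 != 0) ->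
  (forall k, (2 <= k)%N -> exists2 a, a != 0 & @top_pair R sk k 5 = (- a, 3 * a)) ->
  (top_pair sk m lam).1 = 0 -> nondeg lam m.-1.
Proof.
move=> m2 H6 H5 A0; apply: contrapT => /not_nondeg[n nm [gn [s0|x5]]].
  move/eqP: A0; apply/negP.
  case: n nm gn s0 => [|n] nm gn s0.
    have -> : lam = 6 by move: s0 => /=; lra.
    exact: H6.
  have x3 := sigma_eq0 gn s0.
  rewrite (@top_pairD _ _ _ n); last by lia.
  rewrite x3 (_ : m - n = (m - n.+1).+1)%N ?top_pairS; [|lia..].
  rewrite /stepf (_ : decim 3 = 6); last by rewrite /decim; ring.
  have := H6 (m - n.+1)%N ltac:(lia); case: (top_pair _ _ _) => a e /= a0.
  rewrite (_ : step 3 (a, e) = (2 * a, - 3 * (2 * a))); last first.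
    by rewrite /step /decim /=; congr (_, _); ring.
  by apply: descend3_neq0 => //; rewrite mulf_neq0 // pnatr_eq0.
move/eqP: A0; apply/negP; rewrite (@top_pairD _ _ _ n); last by lia.
have [a a0] := H5 (m - n)%N ltac:(lia); rewrite x5 => ->.
exact: descend5_neq0.
Qed.

End PrimitiveWords.

Lemma sturm_neq0_6 (R : realType) n F (l : nat -> R) : sturm n F l -> (F 6).1 != 0.
Proof.
move=> st; apply/eqP => /(sturm_root _ st)[k Hk l6].
by have [_ _ [_ /(_ k Hk)]] := st; rewrite -l6 ltxx andbF.
Qed.

Lemma sturm_top (R : realType) sk m : (2 <= m)%N ->
  exists n, exists l : nat -> R, sturm n (top_pair sk m) l.
Proof.
elim: m => [//|[//|[_ _|m IHm _]]]; last first.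
  have [n [l st]] := IHm isT; exists (2 * n + 2)%N; rewrite top_pairS //.
  by have [l' st' _] := sturm_step st; exists l'.
rewrite /top_pair; case: sk => /=.
  by have [l st _] := sturm_step (sturm_skew R); exists (2 * 0 + 2)%N, l.
by have [l st _] := sturm_sym R; exists 3, l.
Qed.

Lemma stepf5 (R : realFieldType) (F : R -> R * R) : (F 0).2 != 0 ->
  exists2 a, a != 0 & stepf F 5 = (- a, 3 * a).
Proof.
move=> e0; exists (2 * (F 0).2); first by rewrite mulf_neq0 // pnatr_eq0.
rewrite /stepf (_ : decim 5 = 0); last by rewrite /decim subrr mulr0.
by rewrite /step /decim; congr (_, _); ring.
Qed.

Lemma top_pair5 (R : realType) sk m : (2 <= m)%N ->
  exists2 a, a != 0 & @top_pair R sk m 5 = (- a, 3 * a).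
Proof.
case: m => [//|[//|[_|m _]]].
  rewrite /top_pair; case: sk; first by apply: stepf5; rewrite oner_eq0.
  exists (-1); first by rewrite oppr_eq0 oner_eq0.
  by rewrite /= /sym_init /decim; congr (_, _); ring.
rewrite top_pairS //; apply: stepf5.
by have [n [l [_ _ _ _ /lt0r_neq0]]] := @sturm_top R sk m.+2 isT.
Qed.

Lemma top_pair_nondeg (R : realType) sk m (lam : R) : (2 <= m)%N ->
  (top_pair sk m lam).1 = 0 -> nondeg lam m.-1.
Proof.
move=> m2; apply: root_nondeg => // k k2; last exact: top_pair5.
by have [n [l st]] := @sturm_top R sk k k2; exact: sturm_neq0_6 st.
Qed.

(** * Geometry of the gasket *)

Section Dot.

Variable R : realType.
Implicit Types u v w : 'rV[R]_2.

Lemma dotC u v : dot u v = dot v u.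
Proof. by apply: eq_bigr => k _; rewrite mulrC. Qed.

Lemma dotDl u v w : dot (u + v) w = dot u w + dot v w.
Proof. by rewrite /dot -big_split; apply: eq_bigr => k _; rewrite mxE mulrDl. Qed.

Lemma dotZl (a : R) u v : dot (a *: u) v = a * dot u v.
Proof. by rewrite /dot mulr_sumr; apply: eq_bigr => k _; rewrite mxE mulrA. Qed.

Lemma dotBl u v w : dot (u - v) w = dot u w - dot v w.
Proof. by rewrite dotDl -scaleN1r dotZl mulN1r. Qed.

Lemma dotZr (a : R) u v : dot u (a *: v) = a * dot u v.
Proof. by rewrite dotC dotZl dotC. Qed.

Lemma dotBr u v w : dot u (v - w) = dot u v - dot u w.
Proof. by rewrite dotC dotBl !(dotC u). Qed.

Lemma dot_eq0 u : dot u u = 0 -> u = 0.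
Proof.
move=> /eqP; rewrite /dot psumr_eq0 => [/allP u0|k _]; last by rewrite -expr2 sqr_ge0.
apply/rowP => k; have := u0 k; rewrite mem_index_enum => /(_ isT) /=.
by rewrite -expr2 sqrf_eq0 mxE => /eqP.
Qed.

Lemma dot_sub_continuous (f : 'rV[R]_2 -> 'rV[R]_2) (p : 'rV[R]_2) :
  (forall k, continuous (fun x : 'rV[R]_2 => f x 0 k)) ->
  continuous (fun x : 'rV[R]_2 => dot (x - p) (f x)).
Proof.
move=> fc x.
have -> : (fun x => dot (x - p) (f x)) = (fun x : 'rV[R]_2 =>
    (x 0 ord0 - p 0 ord0) * f x 0 ord0 + (x 0 ord_max - p 0 ord_max) * f x 0 ord_max).
  apply/funext => y; rewrite /dot !big_ord_recl big_ord0 addr0 !mxE.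
  by have -> : lift ord0 ord0 = ord_max :> 'I_2 by exact/val_inj.
have H k : {for x, continuous (fun y : 'rV[R]_2 => y 0 k - p 0 k)}.
  by apply: continuousB; [exact: coord_continuous|exact: cst_continuous].
suff : {for x, continuous (fun x : 'rV[R]_2 =>
    (x 0 ord0 - p 0 ord0) * f x 0 ord0 + (x 0 ord_max - p 0 ord_max) * f x 0 ord_max)} by [].
by apply: continuousD; apply: continuousM; by [exact: H|exact: fc].
Qed.

Lemma dot_continuous (u p : 'rV[R]_2) : continuous (fun x : 'rV[R]_2 => dot (x - p) u).
Proof. by apply: dot_sub_continuous => k x; exact: cst_continuous. Qed.

Lemma dot_self_continuous (p : 'rV[R]_2) :
  continuous (fun x : 'rV[R]_2 => dot (x - p) (x - p)).
Proof.
apply: dot_sub_continuous => k x; under eq_fun do rewrite !mxE.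
suff : {for x, continuous (fun y : 'rV[R]_2 => y 0 k - p 0 k)} by [].
by apply: continuousB; [exact: coord_continuous|exact: cst_continuous].
Qed.

End Dot.

(** * Barycentric coordinates and addresses of vertices *)

Section Barycentric.

Variables (R : realType) (q : 'I_3 -> 'rV[R]_2) (d : R).
Hypotheses (d0 : 0 < d)
  (dq : forall i j : 'I_3, i != j -> dot (q i - q j) (q i - q j) = d).

Local Notation a := (q 1 - q 0).
Local Notation b := (q 2%:R - q 0).

Lemma dot_edges : [/\ dot a a = d, dot b b = d & dot a b = d / 2].
Proof.
have aa : dot a a = d by rewrite dq.
have bb : dot b b = d by rewrite dq.
split=> //; have := @dq 1 2%:R isT.
have -> : q 1 - q 2%:R = a - b by rewrite opprB addrA subrK.
move: aa bb; move: a b => u v uu vv.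
by rewrite dotBl !dotBr (dotC v u) uu vv; lra.
Qed.

(** The coefficients $4/(3d)$ and $-2/(3d)$ are the entries of the inverse Gram matrix of the two
    edges at [q 0]. *)
Definition bary (k : 'I_3) (x : 'rV[R]_2) : R :=
  let l1 := (4 * dot (x - q 0) a - 2 * dot (x - q 0) b) / (3 * d) in
  let l2 := (4 * dot (x - q 0) b - 2 * dot (x - q 0) a) / (3 * d) in
  if k == 0 then 1 - l1 - l2 else if k == 1 then l1 else l2.

Lemma bary_sum x : bary 0 x + bary 1 x + bary 2%:R x = 1.
Proof. by rewrite /bary /=; ring. Qed.

Lemma bary_q i k : bary k (q i) = (i == k)%:R.
Proof.
have [aa bb ab] := dot_edges; have dn0 : d != 0 by rewrite gt_eqF.
have dot0 u : dot 0 u = 0 by rewrite -(scale0r 0) dotZl mul0r.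
have ba : dot b a = d / 2 by rewrite dotC.
elim/ord3P: i; rewrite /bary ?subrr ?dot0 ?aa ?bb ?ab ?ba; elim/ord3P: k => /=.
all: by field.
Qed.

Lemma bary_mid k x y : bary k (2^-1 *: (x + y)) = (bary k x + bary k y) / 2.
Proof.
have dn0 : d != 0 by rewrite gt_eqF.
have E u : dot (2^-1 *: (x + y) - q 0) u = (dot (x - q 0) u + dot (y - q 0) u) / 2.
  rewrite !dotBl dotZl dotDl; by field.
by elim/ord3P: k; rewrite /bary /= !E; field.
Qed.

Lemma bary_F i k x : bary k (F q i x) = (bary k x + (i == k)%:R) / 2.
Proof. by rewrite /F bary_mid bary_q. Qed.

Lemma bary_continuous k : continuous (bary k).
Proof.
have ca u : continuous (fun x : 'rV[R]_2 => dot (x - q 0) u) by exact: dot_continuous.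
have l (f : 'rV[R]_2 -> R) (c e h : R) :
    (forall x, f x = c + e * dot (x - q 0) a + h * dot (x - q 0) b) -> continuous f.
  move=> /funext -> x; suff : {for x, continuous (fun x : 'rV[R]_2 =>
    c + e * dot (x - q 0) a + h * dot (x - q 0) b)} by [].
  apply: continuousD; last by apply: continuousM; [exact: cst_continuous|exact: ca].
  apply: continuousD; first exact: cst_continuous.
  by apply: continuousM; [exact: cst_continuous|exact: ca].
have dn0 : d != 0 by rewrite gt_eqF.
elim/ord3P: k.
- by apply: (l _ 1 (- (2 / (3 * d))) (- (2 / (3 * d)))) => x; rewrite /bary /=; field.
- by apply: (l _ 0 (4 / (3 * d)) (- (2 / (3 * d)))) => x; rewrite /bary /=; field.
- by apply: (l _ 0 (- (2 / (3 * d))) (4 / (3 * d))) => x; rewrite /bary /=; field.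
Qed.

Lemma bary_vert w i k : 0 <= bary k (Fw q w (q i)) <= 1.
Proof.
have H0 k' : 0 <= bary k' (Fw q w (q i)).
  elim: w => [|c w IHw] /=; first by rewrite bary_q ler0n.
  by rewrite bary_F divr_ge0 // addr_ge0 // ler0n.
rewrite H0 /=; have := bary_sum (Fw q w (q i)).
by have := H0 0; have := H0 1; have := H0 2%:R; elim/ord3P: k; lra.
Qed.

Lemma F_inj i : injective (F q i).
Proof.
move=> x y /(@scalerI _ _ _ _) H; apply: (addIr (q i)); apply: H.
by rewrite invr_eq0 pnatr_eq0.
Qed.

Lemma Fw_cat w v x : Fw q (w ++ v) x = Fw q w (Fw q v x).
Proof. exact: foldr_cat. Qed.

Lemma F_q i : F q i (q i) = q i.
Proof.
rewrite /F scalerDr -scalerDl (_ : 2^-1 + 2^-1 = 1) ?scale1r //; by field.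
Qed.

Lemma Fw_nseq n i : Fw q (nseq n i) (q i) = q i.
Proof. by elim: n => //= n ->; exact: F_q. Qed.

Lemma vert_glue v i j n :
  Fw q (v ++ i :: nseq n j) (q j) = Fw q (v ++ j :: nseq n i) (q i).
Proof. by rewrite !Fw_cat /= !Fw_nseq /F addrC. Qed.

Lemma bary_eq1 w i j : bary j (Fw q w (q i)) = 1 -> w = nseq (size w) j /\ i = j.
Proof.
elim: w => [|c w IHw] /=.
  by rewrite bary_q; case: eqP => // _ /esym/eqP; rewrite oner_eq0.
rewrite bary_F; have /andP[_ le1] := bary_vert w i j.
case: eqP => [->|_] H; last by exfalso; move: H le1; move: (bary _ _) => t /=; lra.
by have [<- ->] : w = nseq (size w) j /\ i = j by apply: IHw; move: H; rewrite /=; lra.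
Qed.

Lemma bary_F_ge i x : 0 <= bary i x -> 1 / 2 <= bary i (F q i x).
Proof. by rewrite bary_F eqxx /=; lra. Qed.

Lemma vert_eq w w' i j : size w = size w' -> Fw q w (q i) = Fw q w' (q j) ->
  (w = w' /\ i = j) \/
  exists v k l n, [/\ k != l, w = v ++ k :: nseq n l, w' = v ++ l :: nseq n k,
    i = l & j = k].
Proof.
elim: w w' => [|c w IHw] [|c' w'] //= => [_ /(congr1 (bary j))|[sw]].
  by rewrite !bary_q eqxx; case: eqP => [->|_ /esym/eqP]; [left|rewrite oner_eq0].
have [<- /F_inj/(IHw _ sw)[[-> ->]|[v [k [l [n [kl -> -> -> ->]]]]]]|cc' E] := eqVneq c c'.
- by left.
- by right; exists (c :: v), k, l, n.
right; exists [::], c, c', (size w).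
have h1 : bary c (Fw q w' (q j)) = 1.
  have := bary_F_ge (x := Fw q w (q i)) (i := c); rewrite E bary_F eq_sym (negPf cc').
  have /andP[-> h] := bary_vert w i c; have /andP[_ h'] := bary_vert w' j c.
  by move=> /(_ isT) /=; move: h'; lra.
have h2 : bary c' (Fw q w (q i)) = 1.
  have := bary_F_ge (x := Fw q w' (q j)) (i := c'); rewrite -E bary_F (negPf cc').
  have /andP[-> h] := bary_vert w' j c'; have /andP[_ h'] := bary_vert w i c'.
  by move=> /(_ isT) /=; move: h'; lra.
have [-> ->] := bary_eq1 h1; have [-> ->] := bary_eq1 h2.
by rewrite !size_nseq sw; split.
Qed.

Lemma segL_bary x : segL q x -> bary 0 x = 0.
Proof.
have [aa bb ab] := dot_edges; have dn0 : d != 0 by rewrite gt_eqF.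
case=> t _ <-; have -> : (1 - t) *: q 1 + t *: q 2%:R = q 0 + ((1 - t) *: a + t *: b).
  by apply/rowP => k; rewrite !mxE; ring.
rewrite /bary /= [_ - q 0]addrC addKr; move: aa bb ab; move: a b => u v uu vv uv.
by rewrite !dotDl !dotZl uu vv uv (dotC v u) uv; field.
Qed.

Lemma in_segL w i : (Fw q w (q i) \in segL q) = word12 w && (i != 0).
Proof.
apply/idP/idP => [|/andP[w12 i0]].
  rewrite in_setE => /segL_bary; elim: w => [|c w IHw] /=.
    by rewrite bary_q; case: eqP => // _ /eqP; rewrite oner_eq0.
  rewrite bary_F; have /andP[ge0 _] := bary_vert w i 0.
  case: eqP => [_|c0] /=; first by move: ge0; lra.
  by move=> H; apply: IHw; move: H; lra.
rewrite in_setE; elim: w w12 => [_|c w IHw] /=.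
  elim/ord3P: i i0 => // _.
    by exists 0; [rewrite /= in_itv /= lexx ler01|rewrite subr0 scale1r scale0r addr0].
  by exists 1; [rewrite /= in_itv /= lexx ler01|rewrite subrr scale1r scale0r add0r].
move=> /andP[c0 /IHw[t Ht <-]]; move: Ht; rewrite /= in_itv /= => Ht.
elim/ord3P: c c0 => // _; rewrite /F.
  exists (t / 2); first by rewrite /= in_itv /=; lra.
  rewrite !scalerDr !scalerA addrAC -scalerDl.
  by congr (_ *: _ + _ *: _); field.
exists ((t + 1) / 2); first by rewrite /= in_itv /=; lra.
rewrite !scalerDr !scalerA -addrA -scalerDl.
by congr (_ *: _ + _ *: _); field.
Qed.

Lemma mem_VOmega m w i : size w = m ->
  (Fw q w (q i) \in VOmega q m) = ~~ (word12 w && (i != 0)).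
Proof.
move=> sw; rewrite -in_segL /VOmega !inE /=.
suff -> : Fw q w (q i) \in V q m by [].
apply/imfset2P; exists (Tuple (introT eqP sw)) => //=.
by exists i.
Qed.

Lemma VOmegaP m x : x \in VOmega q m ->
  exists w i, [/\ size w = m, x = Fw q w (q i) & ~~ (word12 w && (i != 0))].
Proof.
rewrite /VOmega !inE /= => /andP[/imfset2P[w _ [i _ ->]] nL].
by exists w, i; rewrite size_tuple -in_segL.
Qed.

End Barycentric.

(** * Reflections and the position of the attractor *)

Section Gasket.

Variables (R : realType) (q : 'I_3 -> 'rV[R]_2) (d : R) (SG : set 'rV[R]_2).
Hypotheses (d0 : 0 < d)
  (dq : forall i j : 'I_3, i != j -> dot (q i - q j) (q i - q j) = d)
  (hSG : attractor q SG).

Local Notation bary := (bary q d).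

Lemma refl_q i : refl q [::] (q i) = q (- i).
Proof.
have [aa bb ab] := dot_edges dq; have dn0 : d != 0 by rewrite gt_eqF.
have dd : dot (q 2%:R - q 1) (q 2%:R - q 1) = d by rewrite dq.
have dE : q 2%:R - q 1 = (q 2%:R - q 0) - (q 1 - q 0) by rewrite opprB addrA subrK.
rewrite /refl /= dd.
elim/ord3P: i; rewrite ord3N.
- by rewrite subrr -(scale0r 0) dotZl mul0r mulr0 mul0r scale0r subr0.
- have -> : dot (q 1 - q 0) (q 2%:R - q 1) = - d / 2.
    by rewrite dE dotBr ab aa; field.
  have -> : 2 * (- d / 2) / d = -1 by field.
  by rewrite scaleN1r opprK addrC subrK.
- have -> : dot (q 2%:R - q 0) (q 2%:R - q 1) = d / 2.
    by rewrite dE dotBr bb dotC ab; field.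
  have -> : 2 * (d / 2) / d = 1 by field.
  by rewrite scale1r opprB addrC subrK.
Qed.

Lemma refl_mid x y :
  refl q [::] (2^-1 *: (x + y)) = 2^-1 *: (refl q [::] x + refl q [::] y).
Proof.
rewrite /refl /=; set e := q 2%:R - q 1.
have -> : dot (2^-1 *: (x + y) - q 0) e = (dot (x - q 0) e + dot (y - q 0) e) / 2.
  by rewrite !dotBl dotZl dotDl; field.
by apply/rowP => k; rewrite !mxE; move: (dot e e)^-1 => ee; field.
Qed.

Lemma refl_vert t i : refl q [::] (Fw q t (q i)) = Fw q (map -%R t) (q (- i)).
Proof.
by elim: t => [|c t IHt] /=; [exact: refl_q|rewrite /F refl_mid IHt refl_q].
Qed.

Lemma refl_Fw w x : refl q w (Fw q w x) = Fw q w (refl q [::] x).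
Proof.
elim: w => [//|c w IHw] /=; rewrite -IHw /refl /=.
set y := Fw q w x; set y0 := Fw q w (q 0); set e := Fw q w (q 2%:R) - Fw q w (q 1).
have FB u v : F q c u - F q c v = 2^-1 *: (u - v).
  by rewrite /F -scalerBr opprD addrACA subrr addr0.
rewrite !FB !dotZl !dotZr.
have -> : 2 * (2^-1 * (2^-1 * dot (y - y0) e)) / (2^-1 * (2^-1 * dot e e)) =
    2 * dot (y - y0) e / dot e e.
  (* A zero denominator is harmless, the inverse of 0 being 0 on both sides. *)
  have [->|e0] := eqVneq (dot e e) 0; first by rewrite !mulr0 invr0 !mulr0.
  by field.
by move: (2 * _ / _) => r; rewrite /F; apply/rowP => k; rewrite !mxE; ring.
Qed.

Lemma SG_F i x : SG x -> SG (F q i x).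
Proof. by case: hSG => _ _ {2}-> Sx; exists i => //; exists x. Qed.

(** At a point of [SG] nearest to [q i], applying [F q i] stays in [SG] and halves the distance,
    which is therefore 0. *)
Lemma SG_q i : SG (q i).
Proof.
have [cS neS _] := hSG.
have [|c] := EVT_min_rV neS cS (f := fun x : 'rV[R]_2 => dot (x - q i) (x - q i)).
  by apply: continuous_subspaceT; exact: dot_self_continuous.
rewrite in_setE => Sc cmin.
have := cmin (F q i c); rewrite in_setE => /(_ (SG_F i Sc)).
have -> : F q i c - q i = 2^-1 *: (c - q i).
  by rewrite /F; apply/rowP => k; rewrite !mxE; field.
rewrite dotZl dotZr => le1.
have ge0 : 0 <= dot (c - q i) (c - q i).
  by apply: sumr_ge0 => k _; rewrite -expr2 sqr_ge0.
have /dot_eq0/eqP : dot (c - q i) (c - q i) = 0 by move: le1 ge0; lra.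
by rewrite subr_eq0 => /eqP <-.
Qed.

Lemma SG_vert w i : SG (Fw q w (q i)).
Proof. by elim: w => [|c w IHw]; [exact: SG_q|exact: SG_F]. Qed.

(** The minimum over [SG] is attained at some [F q i y], where the coordinate is at least half that
    of [y], hence at least half the minimum. *)
Lemma SG_bary k x : SG x -> 0 <= bary k x.
Proof.
have [cS neS eS] := hSG; move=> Sx.
have [|c] := EVT_min_rV neS cS (f := bary k).
  by apply: continuous_subspaceT; exact: bary_continuous.
rewrite in_setE => Sc cmin; have := cmin x; rewrite in_setE => /(_ Sx).
apply: le_trans; move: Sc; rewrite eS => -[i _ [y Sy yc]].
have := cmin y; rewrite in_setE => /(_ Sy); rewrite -yc bary_F //.
by have : 0 <= (i == k)%:R :> R by []; lra.
Qed.

Lemma bary_Fw_ge0 v z : (forall k, 0 <= bary k z) -> forall k, 0 <= bary k (Fw q v z).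
Proof.
move=> z0; elim: v => [//|c v IHv] k /=.
by rewrite bary_F // divr_ge0 // addr_ge0.
Qed.

Lemma Fw_inj w : injective (Fw q w).
Proof. by elim: w => [//|c w IHw] x y /= /F_inj/IHw. Qed.

Lemma q_inj : injective q.
Proof.
move=> i j /(congr1 (bary i)); rewrite !bary_q // eqxx; case: eqP => // _ /eqP.
by rewrite oner_eq0.
Qed.

(** Turns membership in the cell of [v] into an address beginning with [v]; the second alternative
    says that the vertex lies on [L]. *)
Lemma vert_in_cell v w i z : word12 v -> (forall k, 0 <= bary k z) ->
  Fw q w (q i) = Fw q v z ->
  (exists t j, (size v + size t)%N = size w /\ Fw q w (q i) = Fw q (v ++ t) (q j)) \/
  (exists w' j, [/\ word12 w', j != 0, size w' = size w
     & Fw q w (q i) = Fw q w' (q j)]).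
Proof.
move=> v12 z0; elim: v v12 w i => [_|c v IHv /= /andP[c0 v12]] w i.
  by left; exists w, i.
have le1 k : bary k (Fw q v z) <= 1.
  have := bary_Fw_ge0 v z0; have := bary_sum q d (Fw q v z).
  by move=> s h; have := h 0; have := h 1; have := h 2%:R; elim/ord3P: k; lra.
have IH w' i' : F q c (Fw q w' (q i')) = F q c (Fw q v z) ->
   (exists t j, ((size v).+1 + size t)%N = (size w').+1 /\
      Fw q (c :: w') (q i') = Fw q ((c :: v) ++ t) (q j)) \/
   (exists w2 j, [/\ word12 w2, j != 0, size w2 = (size w').+1
     & Fw q (c :: w') (q i') = Fw q w2 (q j)]).
  move=> /F_inj/(IHv v12)[[t [j [st E]]]|[w2 [j [w212 j0 sw2 E]]]].
    by left; exists t, j; rewrite /= -E addSn st.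
  by right; exists (c :: w2), j; rewrite /= -E sw2 c0.
case: w => [|c' w] /=.
  move=> E; right; exists [::], i; split=> //; apply: contraTneq isT => i0.
  have := bary_q d0 dq i 0; rewrite [q i]E bary_F // (negPf c0) i0 eqxx /=.
  by have := le1 0; lra.
have [->|cc'] := eqVneq c' c; first exact: IH.
move=> E.
have h1 : bary c (Fw q w (q i)) = 1.
  have := bary_F_ge d0 dq (bary_Fw_ge0 v z0 c); rewrite -E bary_F // (negPf cc').
  by have /andP[_ h] := bary_vert d0 dq w i c; move=> /=; move: h; lra.
have [wE iE] := bary_eq1 d0 dq h1.
have E2 : F q c' (Fw q w (q i)) = F q c (Fw q (nseq (size w) c') (q c')).
  by rewrite wE iE size_nseq !Fw_nseq /F addrC.
have := IH (nseq (size w) c') c'; rewrite -E2 => /(_ E).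
by rewrite size_nseq /= -E2.
Qed.

End Gasket.

(** * From functions on vertices to functions on words *)

Lemma nseq_cat_inj (T : eqType) (a b c : T) k l s t : a != b -> c != b ->
  nseq k b ++ a :: s = nseq l b ++ c :: t -> [/\ k = l, a = c & s = t].
Proof.
move=> ab cb; elim: k l => [|k IHk] [|l] //=.
- by case.
- by case=> e; rewrite e eqxx in ab.
- by case=> e; rewrite e eqxx in cb.
- by case=> /IHk[-> -> ->].
Qed.

Lemma cat_nseq_inj (T : eqType) (a b c : T) k l s t : a != b -> c != b ->
  s ++ a :: nseq k b = t ++ c :: nseq l b -> [/\ s = t, a = c & k = l].
Proof.
move=> ab cb /(congr1 rev); rewrite !rev_cat !rev_cons !rev_nseq !cat_rcons.
by case/(nseq_cat_inj ab cb) => -> -> /(can_inj revK).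
Qed.

Lemma cat_cons_inj2 (T : eqType) (a b c e : T) s s' t t' v w : a != b -> c != e ->
  v ++ a :: s = w ++ c :: s' -> v ++ b :: t = w ++ e :: t' ->
  [/\ v = w, a = c & b = e].
Proof.
move=> ab ce; elim: v w => [|x v IHv] [|y w] //=.
- by case=> -> _ [-> _].
- by case=> e1 _ [e2 _]; rewrite e1 e2 eqxx in ab.
- by case=> e1 _ [e2 _]; rewrite -e1 -e2 eqxx in ce.
- by case=> -> /IHv H [/H[-> -> ->]].
Qed.

Lemma nseqVcat (T : eqType) (w : seq T) (b : T) :
  w = nseq (size w) b \/ exists v a k, a != b /\ w = v ++ a :: nseq k b.
Proof.
elim: w => [|c w [->|[v [a [k [ab ->]]]]]]; first by left.
  have [->|cb] := eqVneq c b; first by left; rewrite /= size_nseq.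
  by right; exists [::], c, (size w).
by right; exists (c :: v), a, k.
Qed.

Lemma word12_cat v w : word12 (v ++ w) = word12 v && word12 w.
Proof. exact: all_cat. Qed.

Lemma word12_nseq k (a : 'I_3) : word12 (nseq k a) = (k == 0%N) || (a != 0).
Proof. by rewrite /word12 all_nseq. Qed.

(** * Gluing conditions and symmetries listed by address *)

Section Flat.

Variables (R : realFieldType) (lam : R).

(* Gluing at the vertex [F_v F_a q_b = F_v F_b q_a] when the cells have level
   [size v + k.+1]. *)
Definition glue_val (U : cellfun R) v (a b : 'I_3) k :=
  U (v ++ a :: nseq k b) b = U (v ++ b :: nseq k a) a.

Definition glue_flux (U : cellfun R) v (a b : 'I_3) k :=
  flux lam (U (v ++ a :: nseq k b)) b + flux lam (U (v ++ b :: nseq k a)) a = 0.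

(** Selects the junctions off [L] and off the bottom row. For [v] in the symbols 1 and 2, two
    nonzero letters give a vertex on [L], and a letter 0 with [k = 0] one on the bottom row. *)
Definition inner v (a b : 'I_3) k : bool :=
  ~~ word12 v || (((a == 0) || (b == 0)) && (0 < k)%N).

Lemma sol_flat n (U : cellfun R) : sol lam n U <->
  forall v a b k, (size v + k.+1)%N = n -> a != b ->
    glue_val U v a b k /\ glue_flux U v a b k.
Proof.
elim: n U => [|n IHn] U; first by split=> // _ v a b k; rewrite addnS.
split=> [[sU gU] [|c v] a b k|H].
- by rewrite add0n => -[->] ab; exact: gU.
- by rewrite addSn => -[vk] ab; have /IHn H := sU c; exact: H vk ab.
split=> [c|a b ab]; last by have := H [::] a b n erefl ab.
by apply/IHn => v a b k vk ab; apply: (H (c :: v)) => //=; rewrite addSn vk.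
Qed.

Lemma dom_flat m (U : cellfun R) : dom lam m U <->
  [/\ forall w i, size w = m -> word12 w -> U w i = 0,
      forall v a b k, (size v + k.+1)%N = m -> a != b -> glue_val U v a b k
    & forall v a b k, (size v + k.+1)%N = m -> a != b -> inner v a b k ->
        glue_flux U v a b k].
Proof.
elim: m U => [|m IHm] U.
  split=> [U0|[U0 _ _] i]; last exact: U0.
  by split=> [w i /size0nil ->//|v a b k|v a b k]; rewrite addnS.
split=> [[sU dU vU fU]|[H0 H1 H2]].
  have U0 w i : size w = m.+1 -> word12 w -> U w i = 0.
    case: w => [//|c w] [sw] /= /andP[c0 w12].
    by have /IHm[H _ _] := dU c c0; exact: H.
  split=> // [[|c v] a b k|[|c v] a b k].
  - rewrite add0n => -[->] ab; rewrite /glue_val /=.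
    have [a0|a0] := eqVneq a 0; first by subst a; apply: vU; rewrite eq_sym.
    have [b0|b0] := eqVneq b 0; first by subst b; apply/esym/vU.
    by rewrite !U0 //= ?size_nseq // word12_nseq ?a0 ?b0 orbT.
  - rewrite addSn => -[vk] ab; have [c0|c0] := eqVneq c 0.
      by subst c; have /sol_flat/(_ v a b k vk ab)[] := sU.
    by have /IHm[_ H _] := dU c c0; exact: H.
  - rewrite add0n => -[->] ab; rewrite /inner /= => /andP[ab0 k0].
    have [a0|a0] := eqVneq a 0; first by subst a; apply: fU; rewrite // eq_sym.
    move: ab0; rewrite (negPf a0) /= => /eqP b0; subst b.
    by rewrite /glue_flux addrC; exact: fU.
  - rewrite addSn => -[vk] ab; have [c0|c0] := eqVneq c 0.
      by subst c; have /sol_flat/(_ v a b k vk ab)[] := sU.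
    by rewrite /inner /= c0 /= => i; have /IHm[_ _ H] := dU c c0; exact: H.
split.
- apply/sol_flat => v a b k vk ab; split.
    by apply: (H1 (0 :: v)) => //=; rewrite addSn vk.
  by apply: (H2 (0 :: v)) => //=; rewrite addSn vk.
- move=> c c0; apply/IHm; split.
  + by move=> w i sw w12; apply: H0; rewrite /= ?sw ?c0.
  + by move=> v a b k vk ab; apply: (H1 (c :: v)) => //=; rewrite addSn vk.
  + move=> v a b k vk ab inn; apply: (H2 (c :: v)) => //=; first by rewrite addSn vk.
    by rewrite /inner /= c0.
- by move=> i i0; apply: (H1 [::] 0 i m) => //; rewrite eq_sym.
- by move=> m0 i i0; apply: (H2 [::] 0 i m) => //; rewrite eq_sym.
Qed.

Lemma allsym_flat k (U : cellfun R) : allsym k U <->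
  forall v t i, word12 v -> (size v + size t)%N = k ->
    U (v ++ map -%R t) (- i) = U (v ++ t) i.
Proof.
elim: k U => [|k IHk] U.
  split=> [[mU _] v t i _|H]; last first.
    by split=> // w i sw; exact: (H [::] w i isT sw).
  by case: v => [|//]; case: t => // _; exact: mU.
split=> [[mU sU] [|c v] t i|H].
- by move=> _ st; exact: mU.
- by rewrite /= addSn => /andP[c0 v12] [vt]; have /IHk H := sU c c0; exact: H.
split=> [w i sw|c c0]; first exact: (H [::] w i isT sw).
by apply/IHk => v t i v12 vt; apply: (H (c :: v)); rewrite /= ?c0 // addSn vt.
Qed.

End Flat.

Lemma innerC v a b k : inner v a b k = inner v b a k.
Proof. by rewrite /inner [(a == 0) || _]orbC. Qed.

Lemma inner_word12 v a b k : a != b -> inner v a b k -> ~~ word12 (v ++ a :: nseq k b).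
Proof.
rewrite /inner word12_cat /= word12_nseq => ab.
by case: (word12 v) => //=; case: eqP => //= _ /andP[/eqP -> k0]; rewrite eqxx orbF -lt0n.
Qed.

(** * Extension by zero along the bottom line and the Dirichlet problem *)

Section Extension.

Variables (R : realType) (q : 'I_3 -> 'rV[R]_2) (d : R).
Hypotheses (d0 : 0 < d)
  (dq : forall i j : 'I_3, i != j -> dot (q i - q j) (q i - q j) = d).

Lemma inner_bd m v a b k : a != b -> (size v + k.+1)%N = m -> inner v a b k ->
  ~~ bdOmega q m (Fw q (v ++ a :: nseq k b) (q b)).
Proof.
move=> ab vk inn.
have sw : size (v ++ a :: nseq k b) = m by rewrite size_cat /= size_nseq.
have w12 := inner_word12 ab inn.
have w12' : ~~ word12 (v ++ b :: nseq k a) by rewrite inner_word12 1?eq_sym // innerC.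
rewrite /bdOmega negb_or; apply/andP; split.
  apply/eqP => E; have b1 : bary q d 0 (Fw q (v ++ a :: nseq k b) (q b)) = 1.
    by rewrite E bary_q // eqxx.
  have [wE b0] := bary_eq1 d0 dq b1.
  have : a \in nseq (size (v ++ a :: nseq k b)) (0 : 'I_3).
    by rewrite -wE mem_cat inE eqxx orbT.
  by rewrite mem_nseq b0 => /andP[_ /eqP a0]; rewrite a0 b0 eqxx in ab.
apply/existsP => -[w /andP[ww /eqP E]].
have [|[wE _]|[v' [k' [l' [n' [kl wE wE' bl k0]]]]]] := vert_eq d0 dq _ E.
- by rewrite sw size_tuple.
- by rewrite wE ww in w12.
subst l' k'; have [vv aa kk] := cat_nseq_inj ab kl wE.
by move: ww; rewrite wE' -vv -kk -aa (negPf w12').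
Qed.

Lemma not_inner_bd m v a b k : a != b -> (size v + k.+1)%N = m -> ~~ inner v a b k ->
  Fw q (v ++ a :: nseq k b) (q b) \in VOmega q m ->
  bdOmega q m (Fw q (v ++ a :: nseq k b) (q b)).
Proof.
move=> ab vk; rewrite /inner negb_or negbK => /andP[v12].
have sw c e : size (v ++ c :: nseq k e) = m by rewrite size_cat /= size_nseq.
rewrite (mem_VOmega d0 dq) // word12_cat v12 /= word12_nseq.
have bd c e : c != 0 -> k = 0%N -> Fw q (v ++ c :: nseq k e) (q 0) =
    Fw q (v ++ a :: nseq k b) (q b) -> bdOmega q m (Fw q (v ++ a :: nseq k b) (q b)).
  move=> c0 k0 E; rewrite /bdOmega; apply/orP; right; apply/existsP.
  exists (Tuple (introT eqP (sw c e))).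
  by rewrite /= E eqxx andbT word12_cat v12 /= c0 k0.
have [a0|a0] := eqVneq a 0.
  rewrite /= -leqNgt leqn0 => /eqP k0 _; apply: (bd b 0) => //.
    by rewrite -a0 eq_sym.
  by rewrite a0 vert_glue.
have [b0|b0] := eqVneq b 0; last by rewrite ?orbT.
rewrite /= -leqNgt leqn0 => /eqP k0 _; apply: (bd a b) => //.
by rewrite b0.
Qed.

Variable m : nat.
Implicit Type u : {ffun VOmega q m -> R^o}.

(** On words of length [m], [insub] fails exactly at the vertices on [L], where the default 0 is the
    value required by [dom]. *)
Definition ext u : cellfun R := fun w i => oapp u 0 (insub (Fw q w (q i))).

Lemma ext_val u (x : VOmega q m) w i : val x = Fw q w (q i) -> ext u w i = u x.
Proof. by move=> E; rewrite /ext -E valK. Qed.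

Lemma ext_eq u w w' i j : Fw q w (q i) = Fw q w' (q j) -> ext u w i = ext u w' j.
Proof. by rewrite /ext => ->. Qed.

Lemma ext_out u w i : size w = m -> word12 w -> i != 0 -> ext u w i = 0.
Proof.
move=> sw w12 i0; rewrite /ext insubN //.
by rewrite (mem_VOmega d0 dq) // w12 i0.
Qed.

(** By [vert_eq] the vertex has exactly two addresses, and their cells share no other vertex. Its
    neighbours are the other corners of these cells, all off [L] since neither word is in the
    symbols 1 and 2. *)
Lemma neighbor_sum u (x : VOmega q m) v a b k : a != b -> (size v + k.+1)%N = m ->
  inner v a b k -> val x = Fw q (v ++ a :: nseq k b) (q b) ->
  \sum_(y : VOmega q m | adj q m (val x) (val y)) (u x - u y) =
  \sum_j (u x - ext u (v ++ a :: nseq k b) j) +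
  \sum_j (u x - ext u (v ++ b :: nseq k a) j).
Proof.
move=> ab vk inn xE.
set w := v ++ a :: nseq k b; set w' := v ++ b :: nseq k a.
have xE' : val x = Fw q w' (q a) by rewrite xE vert_glue.
have sw : size w = m by rewrite size_cat /= size_nseq.
have sw' : size w' = m by rewrite size_cat /= size_nseq.
have w12 : ~~ word12 w := inner_word12 ab inn.
have w12' : ~~ word12 w' by rewrite inner_word12 1?eq_sym // innerC.
pose g (p : 'rV[R]_2) : R := u x - oapp u 0 (insub p).
have gval i (e : seq 'I_3) : u x - ext u e i = g (Fw q e (q i)) by [].
have skip e i : val x = Fw q e (q i) ->
    \sum_j (u x - ext u e j) = \sum_(j | j != i) g (Fw q e (q j)).
  move=> E; rewrite (bigD1 i) //= (ext_val u E) subrr add0r.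
  by apply: eq_bigr => j _.
rewrite (skip w b) // (skip w' a) //.
pose pts := [seq Fw q w (q j) | j <- index_enum 'I_3 & j != b] ++
            [seq Fw q w' (q j) | j <- index_enum 'I_3 & j != a].
have -> : \sum_(j | j != b) g (Fw q w (q j)) + \sum_(j | j != a) g (Fw q w' (q j)) =
    \sum_(p <- pts) g p.
  by rewrite big_cat !big_map !big_filter.
transitivity (\sum_(p <- [seq p <- VOmega q m | adj q m (val x) p]) g p).
  rewrite big_filter big_seq_fsetE; apply: eq_bigr => y _.
  by rewrite /g valK.
apply: perm_big; apply: uniq_perm.
- by rewrite filter_uniq // fset_uniq.
- rewrite cat_uniq !map_inj_in_uniq ?filter_uniq ?index_enum_uniq //=; last first.
    by move=> i j _ _ /Fw_inj/(q_inj d0 dq).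
    by move=> i j _ _ /Fw_inj/(q_inj d0 dq).
  rewrite andbT; apply/hasPn => p /mapP[j]; rewrite mem_filter => /andP[ja _] ->.
  apply/negP => /mapP[i]; rewrite mem_filter => /andP[ib _] E.
  have [|[E' _]|[v' [k' [l' [n' [kl wE wE' jl ik]]]]]] := vert_eq d0 dq _ E.
  + by rewrite sw sw'.
  + have ba : b = a.
      have := congr1 (fun s => nth a s (size v)) E'.
      by rewrite !nth_cat ltnn subnn.
    by rewrite ba eqxx in ab.
  have [_ bk al] : [/\ v = v', b = k' & a = l'].
    by apply: cat_cons_inj2 wE wE' => //; rewrite eq_sym.
  by rewrite jl al eqxx in ja.
move=> p; rewrite mem_filter mem_cat; apply/andP/orP.
  move=> [/andP[xp /existsP[w0 /andP[/existsP[i0 /eqP E0] /existsP[j0 /eqP pE]]]] _].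
  have sw0 : size w = size w0 by rewrite sw size_tuple.
  have h : w0 = w :> seq _ /\ i0 = b \/ w0 = w' :> seq _ /\ i0 = a.
    have [[wE bi]|[v' [k' [l' [n' [kl wE wE' bl ik]]]]]] :=
      vert_eq d0 dq sw0 (etrans (esym xE) E0); first by left.
    right; subst l' i0; have [vv aa kk] := cat_nseq_inj ab kl wE.
    by rewrite wE' -vv -aa -kk.
  have j0i : j0 != i0 by apply: contraNneq xp => ji; rewrite E0 pE ji.
  case: h => -[wE iE]; [left|right]; rewrite pE wE; apply: map_f;
    by rewrite mem_filter mem_index_enum -iE j0i.
have nadj e i j : size e = m -> ~~ word12 e -> val x = Fw q e (q i) -> j != i ->
    adj q m (val x) (Fw q e (q j)) /\ Fw q e (q j) \in VOmega q m.
  move=> se e12 E ji; rewrite (mem_VOmega d0 dq) // (negPf e12); split=> //.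
  apply/andP; split.
    by rewrite E; apply: contraNneq ji => /Fw_inj/(q_inj d0 dq) ->.
  apply/existsP; exists (Tuple (introT eqP se)); apply/andP.
  by split; apply/existsP; [exists i; rewrite E|exists j].
by case=> /mapP[j]; rewrite mem_filter => /andP[ji _] ->; [apply: nadj ji|apply: nadj ji].
Qed.

Lemma dirichlet_dom lam u : dirichlet lam u <->
  dom lam m (ext u) /\ bval m (ext u) 0 = 0.
Proof.
have sumE (U : 'I_3 -> R) i : \sum_j (U i - U j) = flux lam U i + lam / 2 * U i.
  by rewrite /flux !sum_ord3; field.
have fluxE (U W : 'I_3 -> R) (i j : 'I_3) (c : R) : U i = c -> W j = c ->
    flux lam U i + flux lam W j = \sum_l (c - U l) + \sum_l (c - W l) - lam * c.
  by move=> Uc Wc; rewrite -{1}Uc -{1}Wc !sumE Uc Wc; field.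
split=> [[bd0 eq]|[/dom_flat[U0 U1 U2] top]].
  split.
    apply/dom_flat; split.
    - move=> w i sw w12; have [i0|i0] := eqVneq i 0; last exact: ext_out.
      have xV : Fw q w (q i) \in VOmega q m.
        by rewrite (mem_VOmega d0 dq) // i0 eqxx andbF.
      rewrite (@ext_val u [` xV]%fset) // bd0 //=; apply/orP; right; apply/existsP.
      by exists (Tuple (introT eqP sw)); rewrite /= w12 i0 eqxx.
    - by move=> v a b k vk ab; apply/ext_eq/vert_glue.
    - move=> v a b k vk ab inn.
      have sw : size (v ++ a :: nseq k b) = m by rewrite size_cat /= size_nseq.
      have xV : Fw q (v ++ a :: nseq k b) (q b) \in VOmega q m.
        by rewrite (mem_VOmega d0 dq) // (negPf (inner_word12 ab inn)).
      have e1 := @ext_val u [` xV]%fset _ b erefl.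
      have e2 := @ext_val u [` xV]%fset _ a (esym (vert_glue q v b a k)).
      rewrite /glue_flux (fluxE _ _ _ _ _ e1 e2).
      rewrite -(@neighbor_sum u [` xV]%fset v a b k ab vk inn erefl) eq ?subrr //.
      exact: inner_bd.
  have xV : q 0 \in VOmega q m.
    have := mem_VOmega d0 dq (w := nseq m 0) 0 (size_nseq _ _).
    by rewrite Fw_nseq eqxx andbF.
  rewrite /bval (@ext_val u [` xV]%fset) ?Fw_nseq // bd0 //=.
  by rewrite /bdOmega eqxx.
split=> x.
  case/orP => [/eqP xE|/existsP[w /andP[w12 /eqP xE]]].
    by rewrite -(@ext_val u x (nseq m 0) 0) ?Fw_nseq.
  by rewrite -(@ext_val u x w 0) // U0 // size_tuple.
move=> nbd; have [w [i [sw xE nL]]] := VOmegaP d0 dq (valP x).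
have [wE|[v [a [k [ab wE]]]]] := nseqVcat w i.
  rewrite wE Fw_nseq in xE.
  have [i0|i0] := eqVneq i 0; first by rewrite xE i0 /bdOmega eqxx in nbd.
  by rewrite wE word12_nseq i0 orbT in nL.
have vk : (size v + k.+1)%N = m by rewrite -sw wE size_cat /= size_nseq.
rewrite wE in xE.
have inn : inner v a i k.
  apply: contraNT nbd => ninn; rewrite xE; apply: not_inner_bd => //.
  by rewrite -xE (valP x).
rewrite (neighbor_sum u ab vk inn xE).
have e1 := ext_val u xE.
have e2 := ext_val u (etrans xE (vert_glue q v a i k)).
have := U2 v a i k vk ab inn; rewrite /glue_flux (fluxE _ _ _ _ _ e1 e2) => /eqP.
by rewrite subr_eq0 => /eqP.
Qed.

End Extension.

(** * Primitive eigenfunctions on the graph *)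

Section Primitive.

Variables (R : realType) (q : 'I_3 -> 'rV[R]_2) (d : R) (SG : set 'rV[R]_2).
Hypotheses (d0 : 0 < d)
  (dq : forall i j : 'I_3, i != j -> dot (q i - q j) (q i - q j) = d)
  (hSG : attractor q SG).

Variable m : nat.
Hypothesis m2 : (2 <= m)%N.
Implicit Type u : {ffun VOmega q m -> R^o}.

Let mK : m.-1.+1 = m.
Proof. by case: m m2. Qed.

Lemma ext_comb u u' (c : R) w i : ext (u + c *: u') w i = ext u w i + c * ext u' w i.
Proof. by rewrite /ext; case: insub => [x|] /=; rewrite ?ffunE // mulr0 addr0. Qed.

Lemma extZ u (c : R) w i : ext (c *: u) w i = c * ext u w i.
Proof. by rewrite /ext; case: insub => [x|] /=; rewrite ?ffunE // mulr0. Qed.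

Lemma ext_eq0 u : (forall w i, size w = m -> ext u w i = 0) -> u = 0.
Proof.
move=> u0; apply/ffunP => x; rewrite ffunE.
have [w [i [sw xE _]]] := VOmegaP d0 dq (valP x).
by rewrite -(ext_val u xE) u0.
Qed.

(** Each vertex takes the value at a chosen address; by [vert_eq] and the gluing of values the
    choice is immaterial. *)
Lemma ext_surj lam (U : cellfun R) : dom lam m U ->
  exists u, forall w i, size w = m -> ext u w i = U w i.
Proof.
move=> /dom_flat[U0 U1 _].
have /choice[rep repE] : forall x : VOmega q m, exists p : seq 'I_3 * 'I_3,
    size p.1 = m /\ val x = Fw q p.1 (q p.2).
  by move=> x; have [w [i [sw xE _]]] := VOmegaP d0 dq (valP x); exists (w, i).
exists [ffun x => U (rep x).1 (rep x).2] => w i sw.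
have [L|nL] := boolP (word12 w && (i != 0)).
  by have /andP[w12 i0] := L; rewrite (ext_out d0 dq) // U0.
have xV : Fw q w (q i) \in VOmega q m by rewrite (mem_VOmega d0 dq).
rewrite (@ext_val _ _ _ _ [` xV]%fset) // ffunE.
have [sr /= rE] := repE [` xV]%fset.
move: (rep _).1 (rep _).2 sr rE => w' j sr rE {xV nL}.
have [|[<- <-]//|[v [a [b [k [ab wE wE' ib ja]]]]]] := vert_eq d0 dq _ rE.
  by rewrite sr.
rewrite wE wE' ib ja; apply/esym/U1 => //.
by rewrite -sw wE size_cat /= size_nseq.
Qed.

Lemma primsol_ext lam sk (U W : cellfun R) : (forall w i, size w = m -> W w i = U w i) ->
  primsol lam sk m U -> primsol lam sk m W.
Proof.
move=> WU [/dom_flat[U0 U1 U2] sU mU top].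
have sz v a b k : (size v + k.+1)%N = m -> size (v ++ a :: nseq k b) = m.
  by move=> <-; rewrite size_cat /= size_nseq.
split.
- apply/dom_flat; split.
  + by move=> w i sw w12; rewrite WU // U0.
  + by move=> v a b k vk ab; rewrite /glue_val !WU ?sz //; exact: U1.
  + move=> v a b k vk ab inn; rewrite /glue_flux.
    have e c f i : flux lam (W (v ++ c :: nseq k f)) i = flux lam (U (v ++ c :: nseq k f)) i.
      by apply: flux_ext => j; rewrite WU ?sz.
    by rewrite !e; exact: U2.
- move=> c c0; apply/allsym_flat => v t i v12 vt; rewrite /subcell.
  have svt s : size s = size t -> size (c :: v ++ s) = m.
    by move=> st; rewrite /= size_cat st vt; lia.
  rewrite !WU ?svt ?size_map //.
  by have /allsym_flat H := sU c c0; exact: H.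
- by move=> w i sw; rewrite /mirror !WU ?size_map //; exact: mU.
- by rewrite /bval WU ?size_nseq.
Qed.

Lemma ext_refl u (eps : R) w t i : (size w + size t)%N = m ->
  (forall x y : VOmega q m, val x = Fw q (w ++ t) (q i) ->
     val y = refl q w (val x) -> u y = eps * u x) ->
  ext u (w ++ map -%R t) (- i) = eps * ext u (w ++ t) i.
Proof.
move=> wt H; have sz s : size s = size t -> size (w ++ s) = m.
  by move=> st; rewrite size_cat st.
have w12 : word12 (w ++ map -%R t) = word12 (w ++ t) by rewrite !word12_cat word12_opp.
have [L|nL] := boolP (word12 (w ++ t) && (i != 0)).
  have /andP[wt12 i0] := L.
  by rewrite !(ext_out d0 dq) ?sz ?size_map ?w12 ?oppr_eq0 // mulr0.
have xV : Fw q (w ++ t) (q i) \in VOmega q m by rewrite (mem_VOmega d0 dq) // sz.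
have yV : Fw q (w ++ map -%R t) (q (- i)) \in VOmega q m.
  by rewrite (mem_VOmega d0 dq) ?sz ?size_map // w12 oppr_eq0.
rewrite (@ext_val _ _ _ u [` xV]%fset (w ++ t) i erefl).
rewrite (@ext_val _ _ _ u [` yV]%fset (w ++ map -%R t) (- i) erefl).
by apply: H => //=; rewrite !Fw_cat refl_Fw (refl_vert d0 dq).
Qed.

Lemma prim_solP lam sk u : prim_sol SG sk lam u <-> primsol lam sk m (ext u).
Proof.
split=> [[/(dirichlet_dom d0 dq)[dU top] s0 sw]|[dU sU mU top]].
  split=> // [c c0|w i sz].
    apply/allsym_flat => v t i v12 vt.
    have := @ext_refl u 1 (c :: v) t i; rewrite mul1r; apply.
      by rewrite /= addSn vt; lia.
    move=> x y xE yE; rewrite mul1r; apply: (sw (c :: v)) => //=; first by rewrite c0.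
    by exists (Fw q t (q i)); [exact: SG_vert|rewrite xE -Fw_cat].
  by apply: (@ext_refl u _ [::] w i) => // x y _; exact: s0.
split; first exact/(dirichlet_dom d0 dq).
- move=> x y yE; have [w [i [sz xE _]]] := VOmegaP d0 dq (valP x).
  rewrite -(ext_val u xE) -mU // /mirror; apply/esym/ext_val.
  by rewrite yE [val x]xE (refl_vert d0 dq).
move=> w w0 w12 x y [z Sz xz] yE.
have [w' [i [sz xE nL]]] := VOmegaP d0 dq (valP x).
have [|[t [j [wt xE']]]|[w2 [j [w212 j0 sw2 E]]]] :=
    @vert_in_cell R q d d0 dq w w' i z w12 (fun k => SG_bary d0 dq hSG k Sz) _.
- by rewrite xz -xE.
- rewrite -xE in xE'; rewrite -(ext_val u xE').
  have -> : u y = ext u (w ++ map -%R t) (- j).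
    by apply/esym/ext_val; rewrite yE xE' !Fw_cat refl_Fw (refl_vert d0 dq).
  case: w w0 w12 wt {xz xE' yE} => [//|c w] _ /= /andP[c0 w12] wt.
  have /allsym_flat H := sU c c0; apply: H => //.
  by move: wt; rewrite sz addSn => <-.
have : val x \in VOmega q m by exact: valP.
by rewrite [val x]xE E (mem_VOmega d0 dq) ?sw2 // w212 j0.
Qed.

(** A cell of level [m.-1] along [L] has a single vertex off [L] and off the bottom row, its top,
    where the value is [bot] up to sign. With [localized_bot], a solution is localized exactly when
    [bot] vanishes. *)
Lemma bot_localized lam sk u : primsol lam sk m (ext u) ->
  bot m.-1 (subcell 1 (ext u)) = 0 -> localized SG u.
Proof.
move=> [/dom_flat[U0 U1 _] sU mU _] b0 w x w12 [z Sz xz].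
have sw := size_tuple w.
have [w' [i [sz xE nL]]] := VOmegaP d0 dq (valP x).
have [|[t [j [wt xE']]]|[w2 [j [w212 j0 sw2 E]]]] :=
    @vert_in_cell R q d d0 dq w w' i z w12 (fun k => SG_bary d0 dq hSG k Sz) _.
- by rewrite xz -xE.
- rewrite -xE in xE'; rewrite -(ext_val u xE').
  case: t wt {xE'} => [|a [|b t]]; rewrite ?sw ?sz /= => wt;
    [exfalso; clear -m2 wt; lia| |exfalso; clear -m2 wt; lia].
  have swa c : size (tval w ++ [:: c]) = m by rewrite size_cat sw addn1 mK.
  have [a0|a0] := eqVneq a 0; last by rewrite U0 ?swa // word12_cat w12 /= a0.
  subst a; have [j0|j0] := eqVneq j 0; last first.
    have := U1 w 0 j 0%N; rewrite /glue_val /= => ->; rewrite ?sw 1?eq_sym ?addn1 ?mK //.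
    by rewrite U0 ?swa // word12_cat w12 /= j0.
  subst j; have sm : size (tval w) = m.-1 by rewrite sw.
  move: w12 sm {xz wt swa sw}; move: (tval w) => s.
  case: s => [|c s] /=; first by move=> _ sm; exfalso; clear -m2 sm; lia.
  move=> /andP[c0 s12] ss.
  have {}ss : size s = m.-1.-1 by rewrite -ss.
  have H v : size v = m.-1.-1 -> word12 v -> ext u (1 :: rcons v 0) 0 = 0.
    by move=> sv v12; rewrite -b0; apply: (allsym_bot (sU 1 isT) sv v12).
  rewrite cats1; move: c0; elim/ord3P: c => // _; first exact: H.
  have := mU (2%:R :: rcons s 0) 0; rewrite /mirror /= map_rcons oppr0 ord3N H.
  + rewrite /= size_rcons ss (_ : m.-2.+2 = m); last by clear -m2; lia.
    move=> /(_ erefl)/esym/eqP.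
    by rewrite mulf_eq0 signr_eq0 /= => /eqP.
  + by rewrite size_map.
  + by rewrite word12_opp.
have : val x \in VOmega q m by exact: valP.
by rewrite [val x]xE E (mem_VOmega d0 dq) ?sw2 // w212 j0.
Qed.

Lemma localized_bot u : localized SG u -> bot m.-1 (subcell 1 (ext u)) = 0.
Proof.
move=> loc; have sz : size (nseq m.-1 (1 : 'I_3)) == m.-1 by rewrite size_nseq.
have E : nseq m.-1 (1 : 'I_3) ++ [:: 0] = 1 :: rcons (nseq m.-1.-1 1) 0.
  by case: m m2 => [//|[//|k]] _ /=; rewrite cats1.
have xV : Fw q (nseq m.-1 1 ++ [:: 0]) (q 0) \in VOmega q m.
  by rewrite (mem_VOmega d0 dq) ?word12_cat ?andbF // size_cat size_nseq addn1 mK.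
rewrite -[LHS]/(ext u (1 :: rcons (nseq m.-1.-1 1) 0) 0) -E.
rewrite (@ext_val _ _ _ _ [` xV]%fset) //; apply: (loc (Tuple sz)).
  by rewrite /= word12_nseq orbT.
by exists (Fw q [:: 0] (q 0)); [exact: SG_vert|rewrite -Fw_cat].
Qed.

Lemma prim_eigenvaluesP sk lam :
  prim_eigenvalues q SG sk m lam <-> (top_pair sk m lam).1 = 0.
Proof.
split=> [[u [/prim_solP pu nloc]]|A0].
  apply/eqP; apply: contra_notT nloc => A0.
  exact: (bot_localized pu (primsol_bot0 m2 pu A0)).
have [U pU bU] := primsol_exists m2 (top_pair_nondeg m2 A0) A0.
have [dU _ _ _] := pU; have [u uE] := ext_surj dU.
have pu := primsol_ext uE pU.
exists u; split; first exact/prim_solP.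
move=> /localized_bot; rewrite -[LHS]/(ext u (1 :: rcons (nseq m.-1.-1 1) 0) 0).
rewrite uE; last by rewrite /= size_rcons size_nseq; lia.
by move/eqP; rewrite [U _ _]bU oner_eq0.
Qed.

(** Subtracting [bot] times the solution with [bot = 1] leaves one with [bot = 0], which vanishes by
    [primsol_uniq], roots being nondegenerate. *)
Lemma prim_multiplicity1 sk lam : (top_pair sk m lam).1 = 0 ->
  prim_multiplicity q SG sk m lam 1.
Proof.
move=> A0; have gm := top_pair_nondeg m2 A0.
have [U pU bU] := primsol_exists m2 gm A0.
have [dU _ _ _] := pU; have [u uE] := ext_surj dU.
have pu := primsol_ext uE pU.
have bu : ext u (1 :: rcons (nseq m.-1.-1 1) 0) 0 = 1.
  by rewrite uE; [exact: bU|rewrite /= size_rcons size_nseq; lia].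
exists <[u]>%VS; split; last first.
  rewrite dim_vline; have [u0|//] := eqVneq u 0.
  by move: bu; rewrite u0 -(scale0r u) extZ mul0r => /esym/eqP; rewrite oner_eq0.
have key u' : prim_sol SG sk lam u' <-> exists c, u' = c *: u.
  rewrite prim_solP; split=> [pu'|[c ->]].
    exists (bot m.-1 (subcell 1 (ext u'))); apply/eqP; rewrite -subr_eq0 -scaleNr; apply/eqP.
    apply: ext_eq0 => w i sw.
    apply: (@primsol_uniq R lam sk m _ m2 gm _ _ w i sw).
      apply: primsol_ext (primsol_comb 1 (- bot m.-1 (subcell 1 (ext u'))) (ltnW m2) pu' pu).
      by move=> v j _; rewrite ext_comb mul1r.
    rewrite -[LHS]/(ext _ (1 :: rcons (nseq m.-1.-1 1) 0) 0) ext_comb bu mulr1.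
    exact: subrr.
  apply: primsol_ext (primsol_comb c 0 (ltnW m2) pu pu) => v j _.
  by rewrite extZ mul0r addr0.
by move=> u'; rewrite key; split=> [/vlineP|/vlineP].
Qed.

End Primitive.

Theorem theorem3p3 (R : realType) (q : 'I_3 -> 'rV[R]_2)
    (SG : set 'rV[R]_2) (hq : equilateral q) (hSG : attractor q SG) :
  interlacing_spectrum (prim_eigenvalues q SG false)
    (prim_multiplicity q SG false) r_ /\
  interlacing_spectrum (prim_eigenvalues q SG true)
    (prim_multiplicity q SG true) s_.
Proof.
have [d d0 dq] := hq.
split; [apply: (interlacing_of_sturm (F := top_pair false))
       |apply: (interlacing_of_sturm (F := top_pair true))].
- exact: top_pairS.
- by case=> [//|[//|m]] _; rewrite /r_ !subSS !subn0 !expnS; lia.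
- by [].
- exact: sturm_sym.
- by move=> m m2 x; exact: (prim_eigenvaluesP d0 dq hSG m2).
- by move=> m m2 x; exact: (prim_multiplicity1 d0 dq hSG m2).
- exact: top_pairS.
- by case=> [//|[//|m]] _; rewrite /s_ !expnS; have := expn_gt0 2 m; lia.
- by [].
(* Level 1 has no roots, so the grid is 0, 5, 6 and the two roots of level 2 lie on either side of
   5. *)
- have [l st gl] := sturm_step (sturm_skew R); exists l => //.
  have /andP[_ l1] := gl 1%N isT; have /andP[l2 _] := gl 2%N isT.
  by move: l1 l2; rewrite /grid /= => -> ->.
- by move=> m m2 x; exact: (prim_eigenvaluesP d0 dq hSG m2).
- by move=> m m2 x; exact: (prim_multiplicity1 d0 dq hSG m2).
Qed.
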